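(* Suppose that the directed graph $\mathbb{G}(A)$ contains a directed spanning tree. Given an admissible formation characterised by $(d_{ij},\mathbf{R})$ and a static target ($\mathbf{v}_0\equiv 0$), consider the system $\dot{\mathbf{p}}_i(t)=\mathbf{u}_i(t)$, $i\in\mathcal{V}$, under the sampled-data controller which, in the local frame of agent $i$, is $$\mathbf{u}_i^{i}(t)=\lambda\|\mathbf{p}_0^i(kh)\|\begin{bmatrix}\gamma\big(R_i^2-\|\mathbf{p}_0^i(kh)\|^2\big)\\ \mu\end{bmatrix}f_i(kh)+\mathbf{v}_0^i(kh),\qquad t\in[kh,kh+h),\ i\in\mathcal{V},\ k=0,1,2,\dots,$$ with $$f_i(kh)=c+\mu\sum_{j\in\mathcal{N}_i}a_{ij}\tanh\big(\hat\alpha_{ij}(kh)-d_{ij}\big).$$ This system has a locally exponentially stable equilibrium which is the desired formation (that is, $\|\mathbf{p}_0^i\|=R_i$ for all $i\in\mathcal{V}$ and $\hat\alpha_{ij}=d_{ij}$ for all $i\in\mathcal{V}$, $j\in\mathcal{N}_i$), if the parameter $c$ satisfies $c>|\mu|\max_{i\in\mathcal{V}}\big(\sum_{j\in\mathcal{N}_i}a_{ij}\big)$ and the sampling period $h$ satisfies $$0<h<h_{\max}=\min\Big(\frac{1}{2\gamma\lambda R^2M},\ \frac{1}{\lambda\mu^2 d_{\max}}\Big),$$ where $R=\max_{i\in\mathcal{V}}(R_i)$, $d_{\max}=\max_{i\in\mathcal{V}}\big(\sum_{j\in\mathcal{N}_i}a_{ij}\big)\le N$, and $M=c+|\mu|\max_{i\in\mathcal{V}}\big(\sum_{j\in\mathcal{N}_i}a_{ij}\big)$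 is the upper bound of $f_i$.
   Context: There are $N\ge2$ agents, $\mathcal{V}=\{1,\dots,N\}$, in the plane. Agent $i$ has position $\mathbf{p}_i\in\mathbb{R}^2$ and control input $\mathbf{u}_i\in\mathbb{R}^2$, both expressed in a global coordinate frame. The target has position $\mathbf{p}_0\in\mathbb{R}^2$ and velocity $\mathbf{v}_0$; it is static here, so $\mathbf{v}_0\equiv0$. Initially no agent occupies the position of the target. The constants satisfy $\lambda>0$, $\gamma>0$, $\mu\ne0$, $c\in\mathbb{R}$. Graph: $\mathbb{G}(A)=(\mathcal{V},\mathcal{E})$ is a directed graph with adjacency matrix $A=(a_{ij})_{N\times N}$, where $a_{ij}>0$ if and only if $(j,i)\in\mathcal{E}$ and $a_{ij}=0$ otherwise; $\mathcal{N}_i=\{j:(j,i)\in\mathcal{E}\}$. A directed tree is a directed graph in which every node except one (the root) has exactly one parent; a directed spanning tree of a graph is a directed tree formed by edges of the graph that connect all its nodes. Local frame: the local frame of agent $i$ has its origin at the agent and its $x$-axis opposite to the direction of the ray from agent $i$ to the target. Let $\alpha_i$ be the angle, in the global frame, of the ray from the target to agent $i$, and let $\Phi_i=\begin{bmatrix}\cos\alpha_i&\sin\alpha_i\\-\sin\alpha_i&\cos\alpha_i\end{bmatrix}$. A superscript $i$ denotes representation in the local frame of agent $i$: $\mathbf{p}_0^i=\Phi_i(\mathbf{p}_0-\mathbf{p}_i)$, $\mathbf{u}_i^i=\Phi_i\mathbf{u}_i$, $\mathbf{v}_0^i=\Phi_i\mathbf{v}_0$. Angular distance: for $j\in\mathcal{N}_i$,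 $\hat\alpha_{ij}(t)$ is the angular distance from agent $i$ to agent $j$. Its initial value $\hat\alpha_{ij}(0)\in[0,2\pi)$ is the angle obtained by rotating counterclockwise the ray from the target to agent $i$ until it reaches agent $j$ at $t=0$, and $\hat\alpha_{ij}(t)$ is required to be continuous in $t$. Sampling: all agents sample synchronously and periodically with the same period $h$, and zero-order hold is used. With $\mathbf{p}_{i0}=\mathbf{p}_0-\mathbf{p}_i$ and $l_i=R_i^2-\|\mathbf{p}_{i0}\|^2$, the resulting closed loop in the global frame, for a static target, is written as $\mathbf{p}_{i0}(kh+h)=\mathbf{p}_{i0}(kh)+h\lambda f_i(kh)\begin{bmatrix}\gamma l_i(kh)&-\mu\\ \mu&\gamma l_i(kh)\end{bmatrix}\mathbf{p}_{i0}(kh)$, $k=0,1,2,\dots$ Admissible formation: $(d_{ij},\mathbf{R})$ is admissible if (i) $\mathbf{R}=[R_1,\dots,R_N]^T\in\mathbb{R}^N$ with all $R_i>0$; (ii) $d_{ij}\in[0,2\pi)$ for $i\in\mathcal{V}$, $j\in\mathcal{N}_i$, and there is a vector $\mathbf{d}=[d_1,\dots,d_N]^T$ with $d_i\in[0,2\pi)$ such that, for all $i\in\mathcal{V}$, $j\in\mathcal{N}_i$, $d_{ij}=d_j-d_i$ when $d_j-d_i\ge0$ and $d_{ij}=d_j-d_i+2\pi$ when $d_j-d_i<0$. Here $R_i$ is the desired distance from agent $i$ to the target and $d_{ij}$ is the desired angular spacing from agent $i$ to agent $j$.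
   Formalization: The input is held in each agent's moving local frame on [kh,kh+h), not by the displayed global recursion, for which the desired formation is not an equilibrium (the distance grows at R_i). The claim d_max ≤ N, false for general weights, is neither assumed nor asserted. *)

(* Defs.v *)
From HB Require Import structures.
From mathcomp Require Import all_boot all_order all_algebra.
From mathcomp Require Import all_classical all_reals all_analysis.
Set Implicit Arguments.
Unset Strict Implicit.
Unset Printing Implicit Defensive.
Import Order.TTheory GRing.Theory Num.Theory.
Import numFieldNormedType.Exports.
Local Open Scope classical_set_scope.
Local Open Scope ring_scope.

(* The library norm on column vectors is the sup norm, hence this one. *)
Definition enorm (R : realType) n (v : 'cV[R]_n) : R :=
  Num.sqrt (\sum_k v k 0 ^+ 2).

Definition vec2 (R : realType) (x y : R) : 'cV[R]_2 :=
  \col_(k < 2) if k == 0 then x else y.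

(* Change of coordinates from the global frame to the frame obtained by turning
   it counterclockwise by [a]:
     [[cos a, sin a], [- sin a, cos a]]. *)
Definition Phi (R : realType) (a : R) : 'M[R]_2 :=
  \matrix_(i < 2, j < 2)
    (if i == j then cos a else if i == 0 then sin a else - sin a).

Definition tanh (R : realType) (x : R) : R :=
  (expR x - expR (- x)) / (expR x + expR (- x)).

(* [v] is a nonzero vector and [a] is one of its polar angles. *)
Definition polar_angle (R : realType) (v : 'cV[R]_2) (a : R) : Prop :=
  v != 0 /\ v = enorm v *: vec2 (cos a) (sin a).

(* [edge A j i] says that (j, i) is an edge, i.e. j is a neighbour of i. *)
Definition edge (R : realType) N (A : 'M[R]_N) : rel 'I_N :=
  fun j i => 0 < A i j.

Definition has_directed_spanning_tree N (e : rel 'I_N) : Prop :=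
  exists (T : rel 'I_N) (root : 'I_N),
    [/\ subrel T e,
        #|[pred u | T u root]| = 0%N,
        forall v, v != root -> #|[pred u | T u v]| = 1%N
      & forall u v, connect [rel x y | T x y || T y x] u v].

Definition admissible (R : realType) N (A : 'M[R]_N)
    (d : 'I_N -> 'I_N -> R) (rad : 'I_N -> R) : Prop :=
  [/\ forall i, 0 < rad i,
      forall i j, edge A j i -> 0 <= d i j < 2 * pi
    & exists dd : 'I_N -> R,
        (forall i, 0 <= dd i < 2 * pi) /\
        (forall i j, edge A j i ->
           d i j = if 0 <= dd j - dd i then dd j - dd i
                   else dd j - dd i + 2 * pi)].

(* The default value 0 of the maxima below is harmless: they are taken over
   nonempty families of nonnegative numbers. *)
Definition max_degree (R : realType) N (A : 'M[R]_N) : R :=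
  \big[Num.max/0]_(i < N) \sum_(j | edge A j i) A i j.

Definition max_radius (R : realType) N (rad : 'I_N -> R) : R :=
  \big[Num.max/0]_(i < N) rad i.

Definition f_bound (R : realType) N (mu c : R) (A : 'M[R]_N) : R :=
  c + `|mu| * max_degree A.

Definition h_max (R : realType) N (lambda gamma mu c : R) (A : 'M[R]_N)
    (rad : 'I_N -> R) : R :=
  Num.min (1 / (2 * gamma * lambda * max_radius rad ^+ 2 * f_bound mu c A))
          (1 / (lambda * mu ^+ 2 * max_degree A)).

(* [bearing q i] is an angle of the ray from the target to agent i, [sep q i j]
   the angular distance from agent i to agent j (meaningful only when j is a
   neighbour of i). *)
Record config (R : realType) (N : nat) := Config {
  pos : 'I_N -> 'cV[R]_2;
  bearing : 'I_N -> R;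
  sep : 'I_N -> 'I_N -> R
}.

Definition wf_config (R : realType) N (A : 'M[R]_N) (p0 : 'cV[R]_2)
    (q : config R N) : Prop :=
  (forall i, polar_angle (pos q i - p0) (bearing q i)) /\
  (forall i j, edge A j i ->
     polar_angle (pos q j - p0) (bearing q i + sep q i j)).

Definition initial_config (R : realType) N (A : 'M[R]_N) (p0 : 'cV[R]_2)
    (q : config R N) : Prop :=
  wf_config A p0 q /\ (forall i j, edge A j i -> 0 <= sep q i j < 2 * pi).

Definition target_local (R : realType) N (p0 : 'cV[R]_2) (q : config R N)
    (i : 'I_N) : 'cV[R]_2 :=
  Phi (bearing q i) *m (p0 - pos q i).

Definition angular_feedback (R : realType) N (mu c : R) (A : 'M[R]_N)
    (d : 'I_N -> 'I_N -> R) (q : config R N) (i : 'I_N) : R :=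
  c + mu * \sum_(j | edge A j i) A i j * tanh (sep q i j - d i j).

(* The control input of agent i in its local frame, computed from the data
   sampled in the configuration [q] (target position [p0], velocity [v0]). *)
Definition controller (R : realType) N (lambda gamma mu c : R) (A : 'M[R]_N)
    (d : 'I_N -> 'I_N -> R) (rad : 'I_N -> R) (p0 v0 : 'cV[R]_2)
    (q : config R N) (i : 'I_N) : 'cV[R]_2 :=
  let r := enorm (target_local p0 q i) in
  (lambda * r * angular_feedback mu c A d q i)
    *: vec2 (gamma * (rad i ^+ 2 - r ^+ 2)) mu
  + Phi (bearing q i) *m v0.

(* [m] is a trajectory of the sampled-data system on [0, +oo[. The zero-order
   hold acts on the components of the input in the local frame: at every
   t in [kh, kh + h[ the local representation Phi_i(t) u_i(t) equals the value
   computed at time kh. The input jumps at the sampling instants, where the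
   positions are only required to be continuous. *)
Definition closed_loop (R : realType) N (lambda gamma mu c h : R)
    (A : 'M[R]_N) (d : 'I_N -> 'I_N -> R) (rad : 'I_N -> R)
    (p0 v0 : R -> 'cV[R]_2) (m : R -> config R N) : Prop :=
  [/\ initial_config A (p0 0) (m 0),
      forall t, 0 <= t -> wf_config A (p0 t) (m t),
      forall i, {within `[0, +oo[, continuous (fun t => pos (m t) i)},
      forall i j, edge A j i ->
        {within `[0, +oo[, continuous (fun t => sep (m t) i j)}
    & exists u : 'I_N -> R -> 'cV[R]_2,
        (forall (i : 'I_N) (k : nat) (t : R),
           k%:R * h < t < k%:R * h + h ->
           is_derive t 1 (fun s => pos (m s) i) (u i t)) /\
        (forall (i : 'I_N) (k : nat) (t : R),
           k%:R * h <= t < k%:R * h + h ->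
           Phi (bearing (m t) i) *m u i t =
           controller lambda gamma mu c A d rad (p0 (k%:R * h)) (v0 (k%:R * h))
             (m (k%:R * h)) i)].

Definition desired_formation (R : realType) N (A : 'M[R]_N)
    (d : 'I_N -> 'I_N -> R) (rad : 'I_N -> R) (p0 : 'cV[R]_2)
    (q : config R N) : Prop :=
  (forall i, enorm (target_local p0 q i) = rad i) /\
  (forall i j, edge A j i -> sep q i j = d i j).

Definition formation_error (R : realType) N (A : 'M[R]_N)
    (d : 'I_N -> 'I_N -> R) (rad : 'I_N -> R) (p0 : 'cV[R]_2)
    (q : config R N) : R :=
  \sum_i `|enorm (target_local p0 q i) - rad i| +
  \sum_i \sum_(j | edge A j i) `|sep q i j - d i j|.

(* In the desired formation the agents may keep circling the target: it is an
   equilibrium in the variables (|p_0^i|)_i and (sep_ij)_ij, and it is in these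
   variables that exponential stability is measured. *)
Definition formation_equilibrium (R : realType) N (lambda gamma mu c h : R)
    (A : 'M[R]_N) (d : 'I_N -> 'I_N -> R) (rad : 'I_N -> R)
    (p0 v0 : R -> 'cV[R]_2) : Prop :=
  (exists q, initial_config A (p0 0) q /\
             desired_formation A d rad (p0 0) q) /\
  (forall m, closed_loop lambda gamma mu c h A d rad p0 v0 m ->
     desired_formation A d rad (p0 0) (m 0) ->
     forall t, 0 <= t -> desired_formation A d rad (p0 t) (m t)).

(* Besides the exponential estimate for all trajectories starting near the
   desired formation, we ask that each initial configuration near it does start
   a trajectory defined for all times. *)
Definition formation_locally_exp_stable (R : realType) N
    (lambda gamma mu c h : R) (A : 'M[R]_N) (d : 'I_N -> 'I_N -> R)
    (rad : 'I_N -> R) (p0 v0 : R -> 'cV[R]_2) : Prop :=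
  exists delta K sigma : R,
    [/\ 0 < delta, 0 < K, 0 < sigma,
        forall q, initial_config A (p0 0) q ->
          formation_error A d rad (p0 0) q < delta ->
          exists m, closed_loop lambda gamma mu c h A d rad p0 v0 m /\ m 0 = q
      & forall m, closed_loop lambda gamma mu c h A d rad p0 v0 m ->
          formation_error A d rad (p0 0) (m 0) < delta ->
          forall t, 0 <= t ->
            formation_error A d rad (p0 t) (m t) <=
            K * formation_error A d rad (p0 0) (m 0) * expR (- sigma * t)].

(* Main.v *)
Require Import Defs.
From HB Require Import structures.
From mathcomp Require Import all_boot all_order all_algebra.
From mathcomp Require Import all_classical all_reals all_analysis.
From mathcomp Require Import ring lra.
Set Implicit Arguments.
Unset Strict Implicit.
Unset Printing Implicit Defensive.
Import Order.TTheory GRing.Theory Num.Theory.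
Import numFieldNormedType.Exports.
Local Open Scope classical_set_scope.
Local Open Scope ring_scope.

(* In polar coordinates around the target, an agent moves during one sampling
   interval with constant radial and transversal speeds, so that its distance
   is affine in time and its angle has a closed form.  The distances obey
   r+ - R = (r - R) (1 - h lambda gamma f r (R + r)), a contraction near R as
   long as f stays in a compact subset of ]0, +oo[, which the bound on c
   ensures.  Up to an error controlled by |r - R| and a drift common to all
   agents, the phases xi, for which sep_ij - d_ij = xi_j - xi_i, obey
   xi_i+ = xi_i + h lambda mu^2 sum_j a_ij tanh (xi_j - xi_i).  Since
   0 <= tanh x / x <= 1, this is an averaging iteration with positive
   self-weights by the second bound on h, so the diameter of the phases
   contracts over as many steps as it takes to reach all the nodes from the
   root of the spanning tree.  A combination of this diameter and of the radius
   errors then decreases geometrically. *)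

(** The held input has constant components in a frame that turns with the agent. Polar coordinates
    therefore integrate the motion exactly, and the estimate at real times between samples involves
    no discretisation error. The obstacle is that angles are real numbers tied to positions only
    modulo [2 * pi], and that [bearing] is not assumed continuous. Along a cycle of the graph the
    errors [sep - d] add up to a multiple of [2 * pi], not necessarily to zero, so the phases [xi]
    need not exist. They do exist when the initial errors are small enough; once there, they
    persist, because [sep] and the phases are driven by the same swept angles. Smallness is needed
    twice more: to keep the radii where they contract, and to keep the phase differences where the
    slope of tanh is bounded below. *)

(** * Angles modulo a full turn *)

Section Angles.
Variable R : realType.
Implicit Types a b x y : R.

(* Congruence modulo 2 pi without an integer witness. *)
Definition eqmod2pi a b := cos (a - b) = 1.

Lemma cos1_sin0 x : cos x = 1 -> sin x = 0.
Proof.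
move=> c1; apply/eqP; rewrite -sqrf_eq0.
by have := cos2Dsin2 x; rewrite c1 expr1n => /(canRL (addKr _)) ->; rewrite addNr.
Qed.

Lemma eqmod2pi_refl a : eqmod2pi a a.
Proof. by rewrite /eqmod2pi subrr cos0. Qed.

Lemma eqmod2pi_sym a b : eqmod2pi a b -> eqmod2pi b a.
Proof. by rewrite /eqmod2pi -(opprB a b) cosN. Qed.

Lemma eqmod2piD a b x y :
  eqmod2pi a b -> eqmod2pi x y -> eqmod2pi (a + x) (b + y).
Proof.
rewrite /eqmod2pi => ab xy.
by rewrite opprD addrACA cosD ab xy !cos1_sin0// mulr1 mulr0 subr0.
Qed.

Lemma eqmod2piN a b : eqmod2pi a b -> eqmod2pi (- a) (- b).
Proof. by rewrite /eqmod2pi => ab; rewrite -opprD cosN. Qed.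

Lemma eqmod2piB a b x y :
  eqmod2pi a b -> eqmod2pi x y -> eqmod2pi (a - x) (b - y).
Proof. by move=> ab /eqmod2piN xy; exact: eqmod2piD. Qed.

Lemma eqmod2pi_trans b a x : eqmod2pi a b -> eqmod2pi b x -> eqmod2pi a x.
Proof.
move=> ab bx; have := eqmod2piD ab bx.
by rewrite /eqmod2pi => <-; congr cos; ring.
Qed.

Lemma eqmod2piD2pi a : eqmod2pi (a + 2 * pi) a.
Proof.
by rewrite /eqmod2pi -addrA addrCA subrr addr0 mulr_natl cos2pi.
Qed.

(** With [x = a - b] positive, [x / 2] lies strictly between 0 and [pi], so its sine is positive and
    [cos x = 1 - 2 sin(x/2)^2 < 1]. *)
Lemma eqmod2pi_small a b : eqmod2pi a b -> `|a - b| < 2 * pi -> a = b.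
Proof.
rewrite /eqmod2pi => ab ltab; apply/eqP; rewrite -subr_eq0.
move: ab ltab; move: (a - b) => {a b}x.
wlog x0 : x / 0 <= x => [hw|].
  have [/hw//|x0] := leP 0 x.
  by rewrite -cosN -normrN -oppr_eq0; apply: hw; lra.
rewrite ger0_norm// => cx ltx; apply: contra_eqT cx => xn0.
have xE : x = x / 2 + x / 2 by lra.
rewrite {1}xE cosD -!expr2 cos2sin2 lt_eqF//.
suff : 0 < sin (x / 2) by move=> s0; have := exprn_gt0 2 s0; lra.
by apply: sin_gt0_pi; lra.
Qed.

Lemma eqmod2pi_cos a b : eqmod2pi a b -> cos a = cos b.
Proof.
move=> ab; rewrite -[a](subrK b) cosD ab cos1_sin0//; ring.
Qed.

Lemma eqmod2pi_sin a b : eqmod2pi a b -> sin a = sin b.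
Proof.
move=> ab; rewrite -[a](subrK b) sinD ab cos1_sin0//; ring.
Qed.

Lemma cos_sin_eqmod2pi a b : cos a = cos b -> sin a = sin b -> eqmod2pi a b.
Proof. by rewrite /eqmod2pi cosB => -> ->; rewrite -!expr2 cos2Dsin2. Qed.

Lemma eqmod2pi_continuous_cst (f : R -> R) a b x :
  {within `[a, b], continuous f} ->
  (forall t, a <= t <= b -> eqmod2pi (f t) x) ->
  forall t, a <= t <= b -> f t = f a.
Proof.
move=> cf fx t /andP[a_t t_b].
have pi2 := @pi_ge2 R.
have a_b : a <= b by exact: le_trans t_b.
have cf' : {within `[a, t], continuous f}.
  by apply: continuous_subspaceW cf => z /=; rewrite !in_itv/= => /andP[-> /le_trans->].
(* An intermediate value at distance at most 1 from [f a]. It is attained, hence congruent to [f a],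
   hence equal to it since [1 < 2 * pi]; this forces [f t = f a]. *)
pose v := if f a <= f t then f a + Num.min (f t - f a) 1
          else f a - Num.min (f a - f t) 1.
have [c] : exists2 c, c \in `[a, t] & f c = v.
  apply: IVT => //; rewrite /v; have [?|?] := leP (f a) (f t).
    by case: (leP (f t - f a) 1) => ?; apply/andP; split; lra.
  by case: (leP (f a - f t) 1) => ?; apply/andP; split; lra.
rewrite in_itv/= => /andP[a_c c_t] fc.
have : v = f a.
  apply: eqmod2pi_small.
    rewrite -fc; apply: (@eqmod2pi_trans x); first by apply: fx; lra.
    by apply: eqmod2pi_sym; apply: fx; rewrite lexx.
  rewrite /v; have [?|?] := leP (f a) (f t).
    by case: (leP (f t - f a) 1) => ?; rewrite ltr_norml; apply/andP; split; lra.
  by case: (leP (f a - f t) 1) => ?; rewrite ltr_norml; apply/andP; split; lra.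
rewrite /v; have [?|?] := leP (f a) (f t).
  by case: (leP (f t - f a) 1) => ?; lra.
by case: (leP (f a - f t) 1) => ?; lra.
Qed.
End Angles.

(** * One-variable derivatives and continuity on subsets of the line *)

Section RealCalculus.
Variable R : realType.
Implicit Types (f g : R -> R) (a b s t : R).

(* Not a class, so that derivatives are computed by explicit rules only. *)
Definition hasD f t a : Prop := is_derive t 1 f a.

Lemma hasD_eq f a b t : hasD f t a -> a = b -> hasD f t b.
Proof. by move=> ? <-. Qed.

Lemma hasD_cst (c : R) t : hasD (fun=> c) t 0.
Proof. exact: is_derive_cst. Qed.

Lemma hasD_id t : hasD (fun s => s) t 1.
Proof. exact: is_derive_id. Qed.

Lemma hasDD f g a b t : hasD f t a -> hasD g t b ->
  hasD (fun s => f s + g s) t (a + b).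
Proof. by rewrite /hasD => fa gb; exact: is_deriveD. Qed.

Lemma hasDN f a t : hasD f t a -> hasD (fun s => - f s) t (- a).
Proof. by rewrite /hasD => fa; exact: is_deriveN. Qed.

Lemma hasDB f g a b t : hasD f t a -> hasD g t b ->
  hasD (fun s => f s - g s) t (a - b).
Proof. by move=> fa gb; apply: hasDD => //; exact: hasDN. Qed.

Lemma hasDM f g a b t : hasD f t a -> hasD g t b ->
  hasD (fun s => f s * g s) t (a * g t + f t * b).
Proof.
rewrite /hasD => fa gb; apply: is_derive_eq; rewrite addrC; congr (_ + _).
by rewrite mulrC.
Qed.

Lemma hasDV f a t : f t != 0 -> hasD f t a ->
  hasD (fun s => (f s)^-1) t (- a / f t ^+ 2).
Proof.
rewrite /hasD => f0 fa; have dV := is_deriveV f0 fa; apply: (is_derive_eq dV).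
by rewrite /GRing.scale/= mulNr mulrC mulNr.
Qed.

Lemma hasD_comp (F : R -> R) f a b t : is_derive (f t) 1 F b -> hasD f t a ->
  hasD (fun s => F (f s)) t (b * a).
Proof. exact: is_derive1_comp. Qed.

Lemma hasD_cos f a t : hasD f t a -> hasD (fun s => cos (f s)) t (- sin (f t) * a).
Proof. by move=> fa; apply: hasD_comp. Qed.

Lemma hasD_sin f a t : hasD f t a -> hasD (fun s => sin (f s)) t (cos (f t) * a).
Proof. by move=> fa; apply: hasD_comp. Qed.

Lemma hasD_affine (p q s0 t : R) : hasD (fun s => p + (s - s0) * q) t q.
Proof.
apply: hasD_eq.
  apply: hasDD; first exact: hasD_cst.
  apply: hasDM; last exact: hasD_cst.
  by apply: hasDB; [exact: hasD_id|exact: hasD_cst].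
by rewrite /=; ring.
Qed.

Lemma hasD_continuous f a t : hasD f t a -> {for t, continuous f}.
Proof.
move=> fa; apply: differentiable_continuous; apply/derivable1_diffP.
exact: (@ex_derive _ _ _ _ _ _ _ fa).
Qed.

(** The derivative is prescribed only in the open interval: the input jumps at the sampling
    instants, where positions are merely continuous. *)
Lemma derive0_within_cst f a b : {within `[a, b], continuous f} ->
  (forall t, a < t < b -> hasD f t 0) ->
  forall t, a <= t <= b -> f t = f a.
Proof.
move=> cf df t /andP[a_t t_b].
have [||c] := @MVT_segment _ f (fun=> 0) _ _ a_t; last first.
- by move=> _; rewrite mul0r => /eqP; rewrite subr_eq0 => /eqP.
- by apply: continuous_subspaceW cf => z /=; rewrite !in_itv/= => /andP[-> /le_trans->].
move=> z; rewrite in_itv/= => /andP[az zt]; apply: df; rewrite az/=.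
exact: lt_le_trans zt t_b.
Qed.

Lemma withinD (D : set R) f g : {within D, continuous f} ->
  {within D, continuous g} -> {within D, continuous (fun t => f t + g t)}.
Proof. by move=> cf cg z; exact: continuousD (cf z) (cg z). Qed.

Lemma withinN (D : set R) f : {within D, continuous f} ->
  {within D, continuous (fun t => - f t)}.
Proof. by move=> cf z; exact: continuousN (cf z). Qed.

Lemma withinB (D : set R) f g : {within D, continuous f} ->
  {within D, continuous g} -> {within D, continuous (fun t => f t - g t)}.
Proof. by move=> cf cg; apply: withinD => //; exact: withinN. Qed.

Lemma withinM (D : set R) f g : {within D, continuous f} ->
  {within D, continuous g} -> {within D, continuous (fun t => f t * g t)}.
Proof. by move=> cf cg z; exact: continuousM (cf z) (cg z). Qed.

Lemma within_comp (D : set R) (F : R -> R) f : continuous F ->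
  {within D, continuous f} -> {within D, continuous (fun t => F (f t))}.
Proof. by move=> cF cf z; apply: continuous_comp; [exact: cf|exact: cF]. Qed.

Lemma hasD_within (df : R -> R) f a b :
  (forall t, a <= t <= b -> hasD f t (df t)) -> {within `[a, b], continuous f}.
Proof.
move=> dfE; apply: continuous_in_subspaceT => t.
by rewrite inE/= in_itv/= => /dfE/hasD_continuous.
Qed.

End RealCalculus.

(** * The angle swept at constant radial and transversal speeds *)

Section Turn.
Variable R : realType.
Implicit Types r s : R.

(* The angle swept in time [s] by a point that starts at distance [r] from the
   target, with constant radial speed [w1] and constant transversal speed [w2]. *)
Definition turn r (w1 w2 : R) s : R :=
  if w1 == 0 then w2 / r * s else w2 / w1 * (ln (r + s * w1) - ln r).

Lemma turn0 r (w1 w2 : R) : turn r w1 w2 0 = 0.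
Proof. by rewrite /turn; case: ifP => _; rewrite ?mulr0// mul0r addr0 subrr mulr0. Qed.

Lemma hasD_turn r (w1 w2 : R) s : 0 < r + s * w1 ->
  hasD (turn r w1 w2) s (w2 / (r + s * w1)).
Proof.
move=> rs; rewrite /turn; have [->|w10] := eqVneq w1 0.
  rewrite mulr0 addr0; apply: hasD_eq.
    by apply: hasDM; [exact: hasD_cst|exact: hasD_id].
  by rewrite /=; ring.
apply: hasD_eq.
  apply: hasDM; first exact: hasD_cst.
  apply: hasDB; last exact: hasD_cst.
  apply: hasD_comp; first exact: is_derive1_ln.
  apply: hasDD; first exact: hasD_cst.
  by apply: hasDM; [exact: hasD_id|exact: hasD_cst].
by rewrite /=; field; rewrite w10 andbT gt_eqF.
Qed.

(** Comparison with uniform rotation at speed [w2 / r]. The factor [|w1|] in the bound matters: the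
    radial speed vanishes at the desired radius, so the error will be proportional to the radius
    error. It comes from [0 <= x - ln (1 + x) <= 2 x^2] for [x >= -1/2], with [x] the relative
    change of radius. *)
Lemma turn_approx r (w1 w2 : R) s : 0 < r -> r / 2 <= r + s * w1 ->
  `|turn r w1 w2 s - s * w2 / r| <= 2 * `|w2| * s ^+ 2 * `|w1| / r ^+ 2.
Proof.
move=> r0 rs; rewrite /turn; have [->|w10] := eqVneq w1 0.
  by rewrite (_ : _ - _ = 0) ?normr0 ?mulr0 ?mul0r//; ring.
pose x := s * w1 / r.
have x1 : 1 / 2 <= 1 + x.
  rewrite -(@ler_pM2r _ r)// mul1r mulrDl mul1r /x divfK ?gt_eqF//; lra.
have x_gt : -1 < x by lra.
have -> : ln (r + s * w1) - ln r = ln (1 + x).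
  rewrite -ln_div ?posrE//; last lra.
  by congr ln; rewrite /x mulrDl divff ?gt_eqF.
have le1 := @le_ln1Dx _ _ x_gt.
(* The lower bound on the logarithm is its upper bound taken at the inverse of [1 + x]. *)
have le2 : - ln (1 + x) <= - x / (1 + x).
  rewrite -lnV ?posrE; last lra.
  have E : (1 + x)^-1 = 1 + (- x / (1 + x)) by field; lra.
  rewrite [X in ln X]E; apply: le_ln1Dx; rewrite ltr_pdivlMr; lra.
have le3 : x - ln (1 + x) <= 2 * x ^+ 2.
  apply: (@le_trans _ _ (x + - x / (1 + x))); first by lra.
  have -> : x + - x / (1 + x) = x ^+ 2 / (1 + x) by field; lra.
  rewrite ler_pdivrMr; last lra.
  have := sqr_ge0 x; nra.
have -> : w2 / w1 * ln (1 + x) - s * w2 / r = w2 / w1 * (ln (1 + x) - x).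
  by rewrite /x; field; rewrite gt_eqF// w10.
rewrite normrM [`|ln _ - _|]distrC (ger0_norm (_ : 0 <= x - _)); last lra.
apply: (@le_trans _ _ (`|w2 / w1| * (2 * x ^+ 2))); first exact: ler_wpM2l.
rewrite le_eqVlt; apply/orP; left; apply/eqP.
have -> : x ^+ 2 = s ^+ 2 * `|w1| ^+ 2 / r ^+ 2.
  by rewrite real_normK ?num_real// /x; field; rewrite gt_eqF.
by rewrite normrM normfV; field; rewrite normr_eq0 w10 gt_eqF.
Qed.

End Turn.

(** * Exact motion of one agent during a sampling interval *)

Section Hold.
Variable R : realType.
Variables (x y u v : R -> R) (s0 h w1 w2 a0 : R).
Let rho t := Num.sqrt (x t ^+ 2 + y t ^+ 2).
Let I t := s0 <= t <= s0 + h.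
Let I' t := s0 < t < s0 + h.
Hypotheses (h_ge0 : 0 <= h)
  (cx : {within `[s0, s0 + h], continuous x})
  (cy : {within `[s0, s0 + h], continuous y})
  (dx : forall t, I' t -> hasD x t (u t))
  (dy : forall t, I' t -> hasD y t (v t))
  (rho_gt0 : forall t, I t -> 0 < rho t)
  (radial : forall t, I' t -> x t * u t + y t * v t = rho t * w1)
  (transversal : forall t, I' t -> x t * v t - y t * u t = rho t * w2)
  (x0 : x s0 = rho s0 * cos a0) (y0 : y s0 = rho s0 * sin a0).

Let I'I t : I' t -> I t.
Proof. by rewrite /I /I' => /andP[/ltW-> /ltW->]. Qed.

Let I0 : I s0. Proof. by rewrite /I lexx lerDl. Qed.

Let rho2 t : rho t ^+ 2 = x t ^+ 2 + y t ^+ 2.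
Proof. by rewrite sqr_sqrtr// addr_ge0// sqr_ge0. Qed.

Lemma hold_radius t : I t -> rho t = rho s0 + (t - s0) * w1.
Proof.
move=> It; pose f t := rho t - (0 + (t - s0) * w1).
suff : f t = f s0 by rewrite /f !add0r subrr mul0r subr0 => <-; ring.
apply: (@derive0_within_cst _ f s0 (s0 + h)) => //.
  apply: withinB; last first.
    by apply: hasD_within => z _; exact: hasD_affine.
  apply: within_comp; first exact: sqrt_continuous.
  by apply: withinD; apply: withinM.
move=> z Iz; have rz := rho_gt0 (I'I Iz).
apply: hasD_eq.
  apply: hasDB; last exact: hasD_affine.
  apply: hasD_comp.
    by apply: is_derive1_sqrt; rewrite -rho2 exprn_gt0.
  by apply: hasDD; apply: hasDM; [exact: dx|exact: dx|exact: dy|exact: dy].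
rewrite -/(rho z); have := radial Iz => e.
have -> : u z * x z + x z * u z + (v z * y z + y z * v z) = 2 * (rho z * w1).
  by rewrite -e; ring.
by field; rewrite gt_eqF.
Qed.

Let phi t := a0 + turn (rho s0) w1 w2 (t - s0).

Let dphi t : I t -> hasD phi t (w2 / rho t).
Proof.
move=> It; apply: hasD_eq.
  apply: hasDD; first exact: hasD_cst.
  apply: (@hasD_comp _ (turn (rho s0) w1 w2)).
    by apply: hasD_turn; rewrite -hold_radius// rho_gt0.
  by apply: hasDB; [exact: hasD_id|exact: hasD_cst].
by rewrite -hold_radius//=; ring.
Qed.

(** No given angle can be differentiated here, so [phi] is a candidate that has to be verified: the
    position, divided by the radius and turned back by [phi], has derivative zero and starts at the
    unit vector (1, 0). *)
Lemma hold_polar t : I t ->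
  x t = rho t * cos (phi t) /\ y t = rho t * sin (phi t).
Proof.
move=> It; have r0 := rho_gt0 It.
(* This affine form of the radius is differentiable everywhere, in particular at the ends of the
   interval. *)
pose r t := rho s0 + (t - s0) * w1.
have rE z : I z -> r z = rho z by move=> Iz; rewrite hold_radius.
pose p t := (x t * cos (phi t) + y t * sin (phi t)) * (r t)^-1.
pose q t := (y t * cos (phi t) - x t * sin (phi t)) * (r t)^-1.
have cV : {within `[s0, s0 + h], continuous (fun t => (r t)^-1)}.
  apply: hasD_within => z Iz; apply: hasDV; last exact: hasD_affine.
  by rewrite rE// gt_eqF// rho_gt0.
have cphi : {within `[s0, s0 + h], continuous phi} by exact: hasD_within dphi.
have cc : {within `[s0, s0 + h], continuous (fun t => cos (phi t))}.
  by apply: within_comp => //; exact: continuous_cos.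
have cs : {within `[s0, s0 + h], continuous (fun t => sin (phi t))}.
  by apply: within_comp => //; exact: continuous_sin.
(* The radial and transversal equations form a linear system in the velocity with determinant
   [rho z ^+ 2]; this and [yv] are its solution. *)
have xu z : I' z -> u z = (w1 * x z - w2 * y z) / rho z.
  move=> Iz; have := radial Iz; have := transversal Iz; have := rho2 z.
  have := rho_gt0 (I'I Iz); move: (rho z) (x z) (y z) (u z) (v z) => {p q}r0' X Y U V.
  move=> rp r2 t1 t2; apply: (mulfI (_ : r0' ^+ 2 != 0)).
    by rewrite expf_eq0 gt_eqF.
  rewrite {1}r2; have -> : r0' ^+ 2 * ((w1 * X - w2 * Y) / r0') = X * (r0' * w1)
    - Y * (r0' * w2).
    by field; rewrite gt_eqF.
  rewrite -t1 -t2; ring.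
have yv z : I' z -> v z = (w1 * y z + w2 * x z) / rho z.
  move=> Iz; have := radial Iz; have := transversal Iz; have := rho2 z.
  have := rho_gt0 (I'I Iz); move: (rho z) (x z) (y z) (u z) (v z) => {p q}r0' X Y U V.
  move=> rp r2 t1 t2; apply: (mulfI (_ : r0' ^+ 2 != 0)).
    by rewrite expf_eq0 gt_eqF.
  rewrite {1}r2; have -> : r0' ^+ 2 * ((w1 * Y + w2 * X) / r0') = Y * (r0' * w1)
    + X * (r0' * w2).
    by field; rewrite gt_eqF.
  rewrite -t1 -t2; ring.
have phi0 : phi s0 = a0 by rewrite /phi subrr turn0 addr0.
have pt : p t = 1.
  have -> : 1 = p s0.
    rewrite /p phi0 x0 y0 rE//.
    have -> : rho s0 * cos a0 * cos a0 + rho s0 * sin a0 * sin a0 =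
      rho s0 * (cos a0 ^+ 2 + sin a0 ^+ 2) by ring.
    by rewrite cos2Dsin2 mulr1 divff// gt_eqF// rho_gt0.
  apply: (@derive0_within_cst _ p s0 (s0 + h)) => //.
    by apply: withinM => //; apply: withinD; apply: withinM.
  move=> z Iz; have rz := rho_gt0 (I'I Iz); have Jz := I'I Iz.
  apply: hasD_eq.
    apply: hasDM; last first.
      apply: hasDV; last exact: hasD_affine.
      by rewrite rE// gt_eqF.
    apply: hasDD; apply: hasDM.
    - exact: dx.
    - exact/hasD_cos/dphi.
    - exact: dy.
    - exact/hasD_sin/dphi.
  rewrite /= -/(r z) rE// xu// yv//; field; rewrite gt_eqF//.
have qt : q t = 0.
  have -> : 0 = q s0.
    by rewrite /q phi0 x0 y0 (_ : _ - _ = 0) ?mul0r//; ring.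
  apply: (@derive0_within_cst _ q s0 (s0 + h)) => //.
    by apply: withinM => //; apply: withinB; apply: withinM.
  move=> z Iz; have rz := rho_gt0 (I'I Iz); have Jz := I'I Iz.
  apply: hasD_eq.
    apply: hasDM; last first.
      apply: hasDV; last exact: hasD_affine.
      by rewrite rE// gt_eqF.
    apply: hasDB; apply: hasDM.
    - exact: dy.
    - exact/hasD_cos/dphi.
    - exact: dx.
    - exact/hasD_sin/dphi.
  rewrite /= -/(r z) rE// xu// yv//; field; rewrite gt_eqF//.
have rn0 : r t != 0 by rewrite rE// gt_eqF.
have {}pt : x t * cos (phi t) + y t * sin (phi t) = rho t.
  by rewrite -[LHS](divfK rn0) -/(p t) pt mul1r rE.
have {}qt : y t * cos (phi t) - x t * sin (phi t) = 0.
  by rewrite -[LHS](divfK rn0) -/(q t) qt mul0r.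
have c2 := cos2Dsin2 (phi t); split.
  rewrite -[x t]mulr1 -c2.
  by transitivity (rho t * cos (phi t) - 0 * sin (phi t)); [rewrite -pt -qt|]; ring.
rewrite -[y t]mulr1 -c2.
by transitivity (rho t * sin (phi t) + 0 * cos (phi t)); [rewrite -pt -qt|]; ring.
Qed.
End Hold.

(** * Bounds on tanh and on its chord slope from the origin *)

Section Tanh.
Variable R : realType.
Implicit Types x : R.

Lemma tanhE x : tanh x = (expR (2 * x) - 1) / (expR (2 * x) + 1).
Proof.
rewrite /tanh expRN (_ : 2 * x = x + x); last by ring.
rewrite expRD; have := expR_gt0 x; move: (expR x) => E E0.
by field; rewrite !gt_eqF// addr_gt0// mulr_gt0.
Qed.

Lemma tanh0 : tanh 0 = 0 :> R.
Proof. by rewrite /tanh oppr0 subrr mul0r. Qed.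

Lemma tanhN x : tanh (- x) = - tanh x.
Proof. by rewrite /tanh opprK -mulNr opprB [X in _ / X]addrC. Qed.

Lemma normr_tanh_le1 x : `|tanh x| <= 1.
Proof.
rewrite tanhE; have E0 := expR_gt0 (2 * x); move: (expR _) E0 => E E0.
have E1 : 0 < E + 1 by lra.
by rewrite ler_norml ler_pdivlMr// ler_pdivrMr//; apply/andP; split; lra.
Qed.

(** The function [x cosh x - sinh x] vanishes at 0 and has derivative [x sinh x], which is
    nonnegative. *)
Lemma tanh_le_id x : 0 <= x -> tanh x <= x.
Proof.
move=> x0; have E0 := expR_gt0 x; have E1 := expR_gt0 (- x).
rewrite /tanh ler_pdivrMr ?addr_gt0//.
pose g (t : R) := t * (expR t + expR (- t)) - (expR t - expR (- t)).
have dg t : hasD g t (t * (expR t - expR (- t))).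
  have dE : hasD (fun s => expR s) t (expR t) by exact: is_derive_expR.
  have dN : hasD (fun s => expR (- s)) t (expR (- t) * (- 1)).
    by apply: hasD_comp; apply/hasDN/hasD_id.
  apply: (hasD_eq (hasDB (hasDM (hasD_id t) (hasDD dE dN)) (hasDB dE dN))).
  by ring.
have [] := @MVT_segment _ g _ _ _ x0 (fun t _ => dg t).
  by apply: hasD_within => t _; exact: dg.
move=> t; rewrite in_itv/= => /andP[t0 tx].
have g0 : g 0 = 0 by rewrite /g mul0r oppr0 !subrr.
rewrite g0 !subr0 => gx.
have h : 0 <= expR t - expR (- t) by rewrite subr_ge0 ler_expR; lra.
have : 0 <= g x by rewrite gx mulr_ge0// mulr_ge0.
by rewrite /g subr_ge0.
Qed.

(* The value at 0 is the limit, so that [tanh x = tanh_slope x * x] always. *)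
Definition tanh_slope x : R := if x == 0 then 1 else tanh x / x.

(** For [0 < x <= 1], [tanh x = (e^(2x) - 1) / (e^(2x) + 1)] has numerator at least [2 x] and
    denominator at most [e^2 + 1]. *)
Definition tanh_slope_min : R := 2 / (expR 2 + 1).

Lemma tanh_slope_min_gt0 : 0 < tanh_slope_min.
Proof. by rewrite divr_gt0// addr_gt0// expR_gt0. Qed.

Lemma tanh_slopeE x : tanh x = tanh_slope x * x.
Proof.
rewrite /tanh_slope; case: eqVneq => [->|x0]; first by rewrite tanh0 mulr0.
by rewrite divfK.
Qed.

Lemma tanh_slopeN x : tanh_slope (- x) = tanh_slope x.
Proof. by rewrite /tanh_slope oppr_eq0 tanhN invrN mulrNN. Qed.

Lemma tanh_slope_bounds x : 0 <= tanh_slope x <= 1.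
Proof.
wlog x0 : x / 0 <= x => [hw|].
  by have [/hw//|x0] := leP 0 x; rewrite -tanh_slopeN; apply: hw; lra.
rewrite /tanh_slope; case: eqVneq => [_|xn0]; first by rewrite ler01 lexx.
have {xn0}x0 : 0 < x by rewrite lt_def xn0.
rewrite ler_pdivrMr// mul1r tanh_le_id ?(ltW x0)// andbT divr_ge0 ?(ltW x0)//.
have E1 : 1 <= expR (2 * x) by have := expR_ge1Dx (2 * x); lra.
by rewrite tanhE divr_ge0//; lra.
Qed.

Lemma tanh_slope_ge x : `|x| <= 1 -> tanh_slope_min <= tanh_slope x.
Proof.
wlog x0 : x / 0 <= x => [hw x1|].
  have [x0|x0] := leP 0 x; first exact: hw.
  by rewrite -tanh_slopeN; apply: hw; rewrite ?normrN//; lra.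
have e2 := expR_ge1Dx (2 : R).
rewrite /tanh_slope_min ger0_norm// => x1; rewrite /tanh_slope.
case: eqVneq => [_|xn0].
  by rewrite ler_pdivrMr; lra.
have {xn0}x0 : 0 < x by rewrite lt_def xn0.
rewrite ler_pdivlMr// tanhE ler_pdivlMr; last by rewrite addr_gt0// expR_gt0.
have E1 : 1 + 2 * x <= expR (2 * x) by exact: expR_ge1Dx.
have E2 : expR (2 * x) <= expR 2 by rewrite ler_expR; lra.
apply: (@le_trans _ _ (2 * x)); last lra.
have -> : 2 / (expR 2 + 1) * x * (expR (2 * x) + 1) =
    2 * x * ((expR (2 * x) + 1) / (expR 2 + 1)) by field; lra.
rewrite -[leRHS]mulr1; apply: ler_wpM2l; first lra.
by rewrite ler_pdivrMr; lra.
Qed.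

End Tanh.

(** * Contraction of averaging iterations over a rooted tree *)

Section Consensus.
Variables (R : realType) (N : nat) (T : rel 'I_N) (root : 'I_N).

(* Reachability from the root along at most [n] edges of [T]. *)
Fixpoint reach n : pred 'I_N :=
  if n is m.+1 then [pred v | reach m v || [exists u, reach m u && T u v]]
  else pred1 root.

(** The default 0 of the maximum is also the value at the diagonal pairs. *)
Definition spread (x : 'I_N -> R) : R :=
  \big[Num.max/0]_(p : 'I_N * 'I_N) (x p.1 - x p.2).

Lemma spread_ge0 x : 0 <= spread x.
Proof. exact: bigmax_ge_id. Qed.

Lemma le_spread x i j : x i - x j <= spread x.
Proof. exact: (@le_bigmax _ _ _ 0 (fun p : 'I_N * 'I_N => x p.1 - x p.2) (i, j)). Qed.

Lemma spread_le x V : 0 <= V -> (forall i j, x i - x j <= V) -> spread x <= V.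
Proof. by move=> V0 xV; apply: bigmax_le => // -[i j] _; exact: xV. Qed.

Lemma normr_le_spread x i j : `|x i - x j| <= spread x.
Proof.
by rewrite ler_norml le_spread andbT lerNl opprB le_spread.
Qed.

Section Upper.
Variables (beta U0 : R) (x : nat -> 'I_N -> R) (w : nat -> 'I_N -> 'I_N -> R)
  (b et : nat -> R) (eta : nat -> 'I_N -> R).
Hypotheses (beta_ge0 : 0 <= beta)
  (xS : forall n i,
     x n.+1 i = b n + x n i + \sum_j w n i j * (x n j - x n i) + eta n i)
  (w_ge0 : forall n i j, 0 <= w n i j)
  (w_sum : forall n i, \sum_j w n i j <= 1 - beta)
  (w_tree : forall n u v, T u v -> beta <= w n v u)
  (eta_le : forall n i, `|eta n i| <= et n)
  (x0U : forall i, x 0 i <= U0).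

(** An upper bound for all nodes that moves with the common drift and pays for the worst
    perturbation of each step. *)
Let U n := U0 + \sum_(k < n) (b k + et k).

(* A node which is below the upper bound by some gap keeps at least the
   fraction [beta] of it, and so do its children in [T]. *)
Lemma consensus_upper n :
  (forall v, x n v <= U n) /\
  (forall v, reach n v -> beta ^+ n * (U0 - x 0 root) <= U n - x n v).
Proof.
elim: n => [|n [xU xR]].
  rewrite /U big_ord0 addr0; split=> // v /= /eqP->.
  by rewrite expr0 mul1r.
(* The new gap is a convex combination of old gaps, with self-weight at least [beta], plus a
   nonnegative term. *)
have step v : U n.+1 - x n.+1 v =
    (1 - \sum_j w n v j) * (U n - x n v) + \sum_j w n v j * (U n - x n j)
    + (et n - eta n v).
  rewrite /U big_ord_recr/= -/(U n) addrA -/(U n) xS.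
  have -> : \sum_j w n v j * (x n j - x n v) =
      (\sum_j w n v j) * (U n - x n v) - \sum_j w n v j * (U n - x n j).
    by rewrite mulr_suml -sumrB; apply: eq_bigr => j _; ring.
  ring.
have eta_ge0 v : 0 <= et n - eta n v.
  by rewrite subr_ge0 (le_trans (ler_norm _))// eta_le.
have self v : beta * (U n - x n v) <= (1 - \sum_j w n v j) * (U n - x n v).
  by apply: ler_wpM2r; [rewrite subr_ge0|have := w_sum n v; lra].
have others v : 0 <= \sum_j w n v j * (U n - x n j).
  by apply: sumr_ge0 => j _; rewrite mulr_ge0 ?subr_ge0.
split=> v.
  rewrite -subr_ge0 step; have := self v; have := others v; have := eta_ge0 v.
  have : 0 <= beta * (U n - x n v) by rewrite mulr_ge0 ?subr_ge0.
  lra.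
(* A node reached earlier keeps its gap through its self-weight; a new one inherits it from its
   parent [u] through the weight [w n v u]. *)
rewrite exprS -mulrA => /= /orP[/xR rv|/existsP[u /andP[/xR ru uv]]].
  rewrite step; have := self v; have := others v; have := eta_ge0 v.
  have := ler_wpM2l beta_ge0 rv; lra.
have : w n v u * (U n - x n u) <= \sum_j w n v j * (U n - x n j).
  rewrite (bigD1 u)//= lerDl; apply: sumr_ge0 => j _.
  by rewrite mulr_ge0 ?subr_ge0.
have : beta * (U n - x n u) <= w n v u * (U n - x n u).
  by apply: ler_wpM2r; [rewrite subr_ge0|exact: w_tree].
rewrite step; have := self v; have := eta_ge0 v.
have : 0 <= beta * (U n - x n v) by rewrite mulr_ge0 ?subr_ge0.
have := ler_wpM2l beta_ge0 ru; lra.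
Qed.

End Upper.

(** Apply [consensus_upper] to [x] and to [- x], starting from the maximum and from minus the
    minimum, and add the two bounds. The drifts [b] and the root values cancel, which leaves
    [1 - beta ^+ n] times the initial spread and both error sums. *)
Lemma consensus (beta : R) (x : nat -> 'I_N -> R)
  (w : nat -> 'I_N -> 'I_N -> R) (b et : nat -> R) (eta : nat -> 'I_N -> R) :
  0 <= beta ->
  (forall n i,
     x n.+1 i = b n + x n i + \sum_j w n i j * (x n j - x n i) + eta n i) ->
  (forall n i j, 0 <= w n i j) ->
  (forall n i, \sum_j w n i j <= 1 - beta) ->
  (forall n u v, T u v -> beta <= w n v u) ->
  (forall n i, `|eta n i| <= et n) ->
  forall n, (forall v, reach n v) ->
  spread (x n) <= (1 - beta ^+ n) * spread (x 0) + 2 * \sum_(k < n) et k.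
Proof.
move=> beta_ge0 xS w_ge0 w_sum w_tree eta_le n rn.
have et_ge0 k : 0 <= et k by exact: le_trans (eta_le k root).
have beta1 : beta <= 1.
  have := w_sum 0%N root; have : 0 <= \sum_j w 0%N root j by exact: sumr_ge0.
  lra.
have betan : beta ^+ n <= 1 by rewrite exprn_ile1.
have [i1 _ i1P] := @arg_maxP _ R _ root predT (x 0) isT.
have [i2 _ i2P] := @arg_minP _ R _ root predT (x 0) isT.
have up := (consensus_upper beta_ge0 xS w_ge0 w_sum w_tree eta_le
  (fun i => i1P i isT) n).2.
have xSN m i : - x m.+1 i = - b m - x m i
    + \sum_j w m i j * (- x m j - - x m i) - eta m i.
  rewrite xS; under [in RHS]eq_bigr do rewrite -opprD mulrN.
  rewrite sumrN; ring.
have lo := (consensus_upper (x := fun m i => - x m i) (b := fun m => - b m)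
  (eta := fun m i => - eta m i) (U0 := - x 0%N i2)
  beta_ge0 xSN w_ge0 w_sum w_tree
  (fun m i => etrans (congr1 (fun z => z <= _) (normrN _)) (eta_le m i))
  (fun i => etrans (lerN2 _ _) (i2P i isT)) n).2.
apply: spread_le => [|i j].
  rewrite addr_ge0 ?mulr_ge0 ?spread_ge0 ?sumr_ge0// ?subr_ge0//.
have := up i (rn i); have := lo j (rn j).
rewrite !big_split/= sumrN.
have : (1 - beta ^+ n) * (x 0%N i1 - x 0%N i2) <= (1 - beta ^+ n) * spread (x 0%N).
  by apply: ler_wpM2l; [rewrite subr_ge0|exact: le_spread].
lra.
Qed.

End Consensus.

(** * Nonexpansive averaging and geometric decay *)

Section FiniteBounds.
Variable R : realType.

Lemma exists_pos_lower_bound (I : finType) (P : pred I) (F : I -> R) :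
  (forall i, P i -> 0 < F i) -> exists2 a, 0 < a & forall i, P i -> a <= F i.
Proof.
move=> F0; exists (\big[Num.min/1]_(i | P i) F i).
  by apply: lt_bigmin.
by move=> i Pi; exact: bigmin_le_cond.
Qed.

(** Nonexpansiveness uses only the convexity of the weights, so it also covers partial steps inside
    a sampling interval. *)
Lemma spread_step N (x y : 'I_N -> R) (w : 'I_N -> 'I_N -> R) (b e : R)
  (eta : 'I_N -> R) : 0 <= e ->
  (forall i, y i = b + x i + \sum_j w i j * (x j - x i) + eta i) ->
  (forall i j, 0 <= w i j) -> (forall i, \sum_j w i j <= 1) ->
  (forall i, `|eta i| <= e) -> spread y <= spread x + 2 * e.
Proof.
move=> e0 yE w0 w1 etae.
apply: spread_le => [|i j]; first by rewrite addr_ge0 ?spread_ge0 ?mulr_ge0.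
have [i1 _ i1P] := @arg_maxP _ R _ i predT x isT.
have [i2 _ i2P] := @arg_minP _ R _ i predT x isT.
have {}i1P k : x k <= x i1 by exact: i1P.
have {}i2P k : x i2 <= x k by exact: i2P.
have up : \sum_j w i j * (x j - x i) <= x i1 - x i.
  apply: (@le_trans _ _ ((\sum_j w i j) * (x i1 - x i))).
    by rewrite mulr_suml; apply: ler_sum => k _; apply: ler_wpM2l => //; have := i1P k; lra.
  by rewrite -[leRHS]mul1r; apply: ler_wpM2r; rewrite ?subr_ge0.
have lo : x i2 - x j <= \sum_k w j k * (x k - x j).
  apply: (@le_trans _ _ ((\sum_k w j k) * (x i2 - x j))); last first.
    by rewrite mulr_suml; apply: ler_sum => k _; apply: ler_wpM2l => //; have := i2P k; lra.
  rewrite -[leLHS]mul1r -subr_ge0 -mulrBl; have := i2P j; have := w1 j; nra.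
have := etae i; have := etae j; rewrite !ler_norml => /andP[? ?] /andP[? ?].
by rewrite !yE; have := le_spread x i1 i2; lra.
Qed.

End FiniteBounds.

(** The contraction acts on blocks of [n] steps; the factor [rho^-1] absorbs an incomplete block. *)
Lemma exp_decay (R : realType) (n : nat) (rho h : R) : (0 < n)%N -> 0 < rho < 1 -> 0 < h ->
  exists2 sigma, 0 < sigma & forall S : nat -> R, (forall k, 0 <= S k) ->
    (forall k, S k.+1 <= S k) -> (forall k, S (n + k)%N <= rho * S k) ->
    forall k, S k <= rho^-1 * S 0%N * expR (- sigma * (k%:R * h)).
Proof.
move=> n0 /andP[rho0 rho1] h0.
have nR : 0 < n%:R :> R by rewrite ltr0n.
have ln0 : ln rho < 0 by rewrite ln_lt0// rho0.
(* Chosen so that one block of duration [n * h] decays by exactly [rho]. *)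
pose sigma := - ln rho / (n%:R * h).
have s0 : 0 < sigma by rewrite divr_gt0 ?oppr_gt0// mulr_gt0.
have expn : expR (- sigma * (n%:R * h)) = rho.
  have -> : - sigma * (n%:R * h) = ln rho.
    by rewrite /sigma; field; rewrite !gt_eqF.
  by rewrite lnK.
exists sigma => // S S0 Smono Sn.
have Sle k : S k <= S 0%N.
  by elim: k => // k; apply: le_trans.
elim/ltn_ind => k IH; have [nk|kn] := leqP n k.
  rewrite -(subnKC nk); apply: (le_trans (Sn _)).
  have := IH (k - n)%N; rewrite ltn_subrL n0 (leq_trans n0 nk) => /(_ isT).
  rewrite -(ler_pM2l rho0) => /le_trans; apply.
  rewrite natrD mulrDl mulrDr expRD expn.
  by rewrite le_eqVlt; apply/orP; left; apply/eqP; ring.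
apply: (le_trans (Sle k)).
rewrite mulrAC -[leLHS]mul1r; apply: ler_wpM2r => //.
rewrite mulrC ler_pdivlMr// mul1r -{1}expn ler_expR.
rewrite !mulNr lerN2 ler_wpM2l// ?(ltW s0)// ler_wpM2r// ?(ltW h0)//.
by rewrite ler_nat ltnW.
Qed.

(** * Sampled dynamics of radii and phases under the gain conditions *)

Section Gains.
Variables (R : realType) (N : nat) (lambda gamma mu c h : R) (A : 'M[R]_N)
  (rad : 'I_N -> R).
Hypotheses (hN : (2 <= N)%N) (hlambda : 0 < lambda) (hgamma : 0 < gamma)
  (hmu : mu != 0) (hA : forall i j, 0 <= A i j) (rad_gt0 : forall i, 0 < rad i)
  (hc : `|mu| * max_degree A < c)
  (hh : 0 < h < h_max lambda gamma mu c A rad).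

(** The deviations are arbitrary, so that the same bounds serve the existence proof, where no phases
    are available, and the phase dynamics. *)
Definition feedback (delta : 'I_N -> 'I_N -> R) i : R :=
  c + mu * \sum_(j | edge A j i) A i j * tanh (delta i j).
Definition speed_rad i r f : R := lambda * r * f * (gamma * (rad i ^+ 2 - r ^+ 2)).
Definition speed_tan r f : R := lambda * r * f * mu.
Definition f_min : R := c - `|mu| * max_degree A.
Definition f_ok f := f_min <= f <= f_bound mu c A.

Lemma degree_le i : \sum_(j | edge A j i) A i j <= max_degree A.
Proof. exact: (@le_bigmax _ _ _ 0 (fun i => \sum_(j | edge A j i) A i j) i). Qed.

Lemma max_degree_ge0 : 0 <= max_degree A.
Proof. exact: bigmax_ge_id. Qed.

Lemma f_min_gt0 : 0 < f_min.
Proof. by rewrite subr_gt0. Qed.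

Lemma f_bound_gt0 : 0 < f_bound mu c A.
Proof.
have d0 : 0 <= `|mu| * max_degree A by rewrite mulr_ge0// max_degree_ge0.
by rewrite /f_bound ltr_wpDr// (le_lt_trans d0).
Qed.

Lemma feedback_ok delta i : f_ok (feedback delta i).
Proof.
have : `|feedback delta i - c| <= `|mu| * max_degree A.
  rewrite /feedback [X in `|X|](_ : _ - _ = mu * \sum_(j | edge A j i) A i j *
    tanh (delta i j)); last by ring.
  rewrite normrM; apply: ler_wpM2l => //.
  apply: le_trans (degree_le i); apply: le_trans (ler_norm_sum _ _ _) _.
  apply: ler_sum => j _; rewrite normrM ger0_norm//.
  by rewrite -[leRHS]mulr1; apply: ler_wpM2l => //; exact: normr_tanh_le1.
by rewrite ler_norml /f_ok /f_min /f_bound => /andP[? ?]; apply/andP; split; lra.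
Qed.

Let i0 : 'I_N := Ordinal (leq_trans (isT : 0 < 2)%N hN).

Lemma max_radius_ge i : rad i <= max_radius rad.
Proof. exact: (@le_bigmax _ _ _ 0 rad i). Qed.

Lemma max_radius_gt0 : 0 < max_radius rad.
Proof. by apply: lt_le_trans (max_radius_ge i0). Qed.

Lemma step_radius : 2 * (h * lambda * gamma * f_bound mu c A) * max_radius rad ^+ 2 < 1.
Proof.
have /andP[h0] := hh; rewrite /h_max lt_min => /andP[+ _].
rewrite ltr_pdivlMr => [|]; first by congr (_ < _); ring.
by rewrite !mulr_gt0// ?exprn_gt0 ?max_radius_gt0 ?f_bound_gt0.
Qed.

Lemma step_degree : h * lambda * mu ^+ 2 * max_degree A < 1.
Proof.
have /andP[h0] := hh; rewrite /h_max lt_min => /andP[_].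
(* At degree zero the quotient in [h_max] is a division by zero, but the claim reads [0 < 1]. *)
have [->|d0] := eqVneq (max_degree A) 0; first by rewrite !mulr0 ltr01.
rewrite ltr_pdivlMr => [|]; first by congr (_ < _); ring.
have mu2 : 0 < mu ^+ 2 by rewrite exprn_even_gt0.
have dp : 0 < max_degree A by rewrite lt_def d0 max_degree_ge0.
by rewrite mulr_gt0// mulr_gt0.
Qed.

(** The constants are uniform in [f], which enters only through its positive bounds; hence the radii
    contract whatever the phases do. The last estimate is the price that the phases pay for a radius
    error. *)
Lemma radius_contract : exists e0 q K : R, [/\ 0 < e0, 0 < q < 1, 0 < K &
  forall i r f, `|r - rad i| <= e0 -> f_ok f ->
    [/\ 0 < r,
        `|r + h * speed_rad i r f - rad i| <= q * `|r - rad i| &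
        forall s, 0 <= s <= h ->
          [/\ `|r + s * speed_rad i r f - rad i| <= `|r - rad i|,
              r / 2 <= r + s * speed_rad i r f &
              `|turn r (speed_rad i r f) (speed_tan r f) s - s * (lambda * f * mu)|
                <= K * `|r - rad i|]]].
Proof.
have /andP[h0 _] := hh; have fm0 := f_min_gt0; have fM0 := f_bound_gt0.
have [rm rm0 rmP] := exists_pos_lower_bound (P := predT) (fun i _ => rad_gt0 i).
have {}rmP i : rm <= rad i by exact: (rmP i isT).
have fmM : f_min <= f_bound mu c A by have /andP[] := feedback_ok (fun _ _ =>
  0) i0; exact: le_trans.
set fM := f_bound mu c A in fM0 fmM *; set RM := max_radius rad.
have RM0 : 0 < RM := max_radius_gt0.
have rmRM : rm <= RM by exact: le_trans (max_radius_ge i0).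
pose B := h * lambda * gamma * fM.
have B0 : 0 < B by rewrite !mulr_gt0.
have B1 : 2 * B * RM ^+ 2 < 1 := step_radius.
(* The first term keeps [r] away from 0; the second keeps the contraction factor nonnegative, and it
   is positive by the first bound on [h]. *)
pose e0 := Num.min (rm / 4) ((1 - 2 * B * RM ^+ 2) / (4 * B * RM)).
pose b := h * lambda * gamma * f_min.
have b0 : 0 < b by rewrite !mulr_gt0.
have bB : b <= B by rewrite /b /B ler_pM2l// !mulr_gt0.
have e00 : 0 < e0.
  by rewrite lt_min !divr_gt0// ?subr_gt0// !mulr_gt0.
have e0rm : e0 <= rm / 4 by rewrite ge_min lexx.
have e0B : 4 * B * RM * e0 <= 1 - 2 * B * RM ^+ 2.
  by rewrite mulrC -ler_pdivlMr ?mulr_gt0// ge_min lexx orbT.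
pose q := 1 - b * rm ^+ 2 / 2.
have rm2 : rm ^+ 2 <= RM ^+ 2 by rewrite ler_pXn2r// ?nnegrE ltW.
have brm : b * rm ^+ 2 <= B * RM ^+ 2.
  by apply: ler_pM => //; rewrite ?sqr_ge0// ltW.
have brm0 : 0 < b * rm ^+ 2 by rewrite mulr_gt0// exprn_gt0.
(* The last constant is [turn_approx] with [w1 = - lambda r f gamma (Q + r) (r - Q)] and
   [w2 = lambda r f mu], where the factors [r] cancel and [Q + r <= 3 * RM]. *)
exists e0, q, (6 * (lambda * fM) ^+ 2 * `|mu| * h ^+ 2 * gamma * RM); split => //.
- by rewrite /q; apply/andP; split; lra.
- by rewrite !mulr_gt0// ?exprn_gt0 ?normr_gt0// mulr_gt0.
move=> i r f re /andP[f1 f2]; have Ri := rmP i; have RiM := max_radius_ge i.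
rewrite -/RM in RiM; rewrite -/fM in f2; set Q := rad i in re Ri RiM *.
have [rl ru] : Q - e0 <= r /\ r <= Q + e0.
  by move: re; rewrite ler_norml => /andP[? ?]; split; lra.
have r0 : 0 < r by lra.
have f0 : 0 < f by lra.
pose P s := s * (lambda * gamma * f) * (r * (Q + r)).
have PE s : r + s * speed_rad i r f - Q = (r - Q) * (1 - P s).
  by rewrite /speed_rad /P -/Q; ring.
have rQ0 : 0 <= r * (Q + r) by rewrite mulr_ge0; lra.
have rQ1 : rm ^+ 2 / 2 <= r * (Q + r) by nra.
have rQ2 : r * (Q + r) <= 2 * RM ^+ 2 + 4 * RM * e0 by nra.
have lg0 : 0 < lambda * gamma by rewrite mulr_gt0.
have lgf0 : 0 < lambda * gamma * f by rewrite mulr_gt0.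
have P0 s : 0 <= s -> 0 <= P s.
  by move=> s0; rewrite /P mulr_ge0// mulr_ge0// ltW.
have Ph : b * rm ^+ 2 / 2 <= P h.
  rewrite /P /b -mulrA; apply: ler_pM => //; rewrite ?divr_ge0 ?sqr_ge0//.
    by rewrite ltW.
  have -> : h * lambda * gamma * f_min = h * (lambda * gamma * f_min) by ring.
  by rewrite !ler_pM2l.
have Pmono s : 0 <= s <= h -> P s <= P h.
  move=> /andP[s0 sh]; rewrite /P; apply: ler_wpM2r => //.
  by apply: ler_wpM2r => //; rewrite ltW// mulr_gt0.
have Ph1 : P h <= 1.
  apply: (@le_trans _ _ (B * (2 * RM ^+ 2 + 4 * RM * e0))); last by lra.
  rewrite /P /B; apply: ler_pM => //; first by rewrite ltW// !mulr_gt0.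
  have -> : h * lambda * gamma * fM = h * (lambda * gamma * fM) by ring.
  by rewrite !ler_pM2l.
split => //.
  rewrite PE normrM mulrC; apply: ler_wpM2r => //.
  by rewrite ger0_norm /q; lra.
move=> s /andP[s0 sh].
have Ps0 := P0 s s0; have Ps1 : P s <= 1 by apply: le_trans (Pmono s _) Ph1; rewrite s0.
(* The moving radius stays between [r] and [Q], and [Q] exceeds [r / 2] because [e0 <= rm / 4]. *)
have half : r / 2 <= r + s * speed_rad i r f.
  have -> : r + s * speed_rad i r f = Q + (r - Q) * (1 - P s) by rewrite -PE; ring.
  have [?|?] := leP r Q; nra.
split => //.
  rewrite PE normrM -[leRHS]mulr1; apply: ler_wpM2l => //.
  by rewrite ger0_norm; lra.
have := turn_approx (speed_tan r f) r0 half.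
have -> : s * speed_tan r f / r = s * (lambda * f * mu).
  by rewrite /speed_tan; field; rewrite gt_eqF.
move=> /le_trans; apply.
have -> : `|speed_tan r f| = lambda * r * f * `|mu|.
  by rewrite /speed_tan normrM ger0_norm// !mulr_ge0// ltW.
have -> : `|speed_rad i r f| = lambda * r * f * gamma * (Q + r) * `|r - Q|.
  have -> : speed_rad i r f = - (lambda * r * f * gamma * (Q + r) * (r - Q)).
    by rewrite /speed_rad -/Q; ring.
  by rewrite normrN normrM ger0_norm// !mulr_ge0// ?ltW//; lra.
have -> : 2 * (lambda * r * f * `|mu|) * s ^+ 2 *
    (lambda * r * f * gamma * (Q + r) * `|r - Q|) / r ^+ 2 =
   (2 * (lambda * f) ^+ 2 * `|mu| * s ^+ 2 * gamma * (Q + r)) * `|r - Q|.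
  by field; rewrite gt_eqF.
apply: ler_wpM2r => //.
have -> : 6 * (lambda * fM) ^+ 2 * `|mu| * h ^+ 2 * gamma * RM =
   2 * (lambda * fM) ^+ 2 * `|mu| * h ^+ 2 * gamma * (3 * RM) by ring.
have lf : 0 <= lambda * f by rewrite mulr_ge0// ltW.
have lfM : 0 <= lambda * fM by rewrite mulr_ge0// ltW.
have lf2 : (lambda * f) ^+ 2 <= (lambda * fM) ^+ 2.
  by rewrite ler_pXn2r ?nnegrE// ler_pM2l.
have s2 : s ^+ 2 <= h ^+ 2 by rewrite ler_pXn2r ?nnegrE// ltW.
have -> : 2 * (lambda * f) ^+ 2 * `|mu| * s ^+ 2 * gamma * (Q + r) =
    (lambda * f) ^+ 2 * s ^+ 2 * (Q + r) * (2 * `|mu| * gamma) by ring.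
have -> : 2 * (lambda * fM) ^+ 2 * `|mu| * h ^+ 2 * gamma * (3 * RM) =
    (lambda * fM) ^+ 2 * h ^+ 2 * (3 * RM) * (2 * `|mu| * gamma) by ring.
apply: ler_wpM2r; first by rewrite mulr_ge0 ?(ltW hgamma)// mulr_ge0.
apply: ler_pM; [|lra| |lra]; first by rewrite mulr_ge0 ?sqr_ge0.
by apply: ler_pM; rewrite ?sqr_ge0.
Qed.

Definition radius_error (r : 'I_N -> R) : R := \sum_i `|r i - rad i|.

Definition hold_rad s (r f : 'I_N -> R) i : R := r i + s * speed_rad i (r i) (f i).

Definition hold_turn s (r f : 'I_N -> R) i : R :=
  turn (r i) (speed_rad i (r i) (f i)) (speed_tan (r i) (f i)) s.

Lemma radius_error_ge i r : `|r i - rad i| <= radius_error r.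
Proof. by rewrite /radius_error (bigD1 i)//= lerDl sumr_ge0. Qed.

Lemma radius_error_ge0 r : 0 <= radius_error r.
Proof. exact: sumr_ge0. Qed.

Lemma hold_bounds : exists e0 q K : R, [/\ 0 < e0, 0 < q < 1, 0 < K &
  forall r f : 'I_N -> R, radius_error r <= e0 -> (forall i, f_ok (f i)) ->
    radius_error (hold_rad h r f) <= q * radius_error r /\
    forall s, 0 <= s <= h ->
      [/\ forall i, 0 < hold_rad s r f i,
          radius_error (hold_rad s r f) <= radius_error r &
          forall i, `|hold_turn s r f i - s * (lambda * f i * mu)|
            <= K * radius_error r]].
Proof.
have [e0 [q [K [e00 q01 K0 H]]]] := radius_contract.
exists e0, q, K; split => // r f re fok.
have rei i : `|r i - rad i| <= e0 by exact: le_trans (radius_error_ge _ _) re.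
split=> [|s sh].
  rewrite /radius_error mulr_sumr; apply: ler_sum => i _.
  by have [] := H i _ _ (rei i) (fok i).
split.
- move=> i; have [r0 _ /(_ s sh)[_ + _]] := H i _ _ (rei i) (fok i).
  by apply: lt_le_trans; rewrite divr_gt0.
- apply: ler_sum => i _.
  by have [_ _ /(_ s sh)[]] := H i _ _ (rei i) (fok i).
- move=> i; have [_ _ /(_ s sh)[_ _ +]] := H i _ _ (rei i) (fok i).
  move=> /le_trans; apply; apply: ler_wpM2l; first exact: ltW.
  exact: radius_error_ge.
Qed.

Definition phase_feedback (xi : 'I_N -> R) : 'I_N -> R :=
  feedback (fun i j => xi j - xi i).

(* Writing tanh as a slope times its argument turns the feedback into an average
   with state-dependent weights. *)
Definition phase_weight s (xi : 'I_N -> R) i j : R :=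
  s * lambda * mu ^+ 2 * (A i j * tanh_slope (xi j - xi i)).

Lemma edge0 i j : ~~ edge A j i -> A i j = 0.
Proof. by rewrite /edge lt_def hA andbT negbK => /eqP. Qed.

Lemma phase_weightE s (xi : 'I_N -> R) i :
  s * (lambda * phase_feedback xi i * mu) =
  s * lambda * mu * c + \sum_j phase_weight s xi i j * (xi j - xi i).
Proof.
rewrite /phase_feedback /feedback /phase_weight.
have -> : \sum_j s * lambda * mu ^+ 2 * (A i j * tanh_slope (xi j - xi i)) *
    (xi j - xi i) =
    s * lambda * mu ^+ 2 * \sum_(j | edge A j i) A i j * tanh (xi j - xi i).
  rewrite mulr_sumr [RHS]big_mkcond/=; apply: eq_bigr => j _.
  case: ifPn => [_|/edge0->]; first by rewrite tanh_slopeE; ring.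
  by rewrite mul0r mulr0 mul0r.
by ring.
Qed.

Lemma phase_weight_ge0 s xi i j : 0 <= s -> 0 <= phase_weight s xi i j.
Proof.
move=> s0; have /andP[? _] := tanh_slope_bounds (xi j - xi i).
have mu2 := sqr_ge0 mu; rewrite /phase_weight mulr_ge0//; last exact: mulr_ge0.
by rewrite mulr_ge0// mulr_ge0// ltW.
Qed.

(** Slopes of tanh are at most 1. By [step_degree] the bound is below 1, so every node keeps a
    positive weight on itself. *)
Lemma phase_weight_sum s xi i : 0 <= s <= h ->
  \sum_j phase_weight s xi i j <= h * lambda * mu ^+ 2 * max_degree A.
Proof.
move=> /andP[s0 sh]; have h0 : 0 <= h by exact: le_trans sh.
rewrite /phase_weight -mulr_sumr.
have l0 : 0 <= lambda by exact: ltW.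
have mu2 : 0 <= mu ^+ 2 by exact: sqr_ge0.
apply: ler_pM.
- by rewrite mulr_ge0// mulr_ge0.
- apply: sumr_ge0 => j _; have /andP[? _] := tanh_slope_bounds (xi j - xi i).
  exact: mulr_ge0.
- by apply: ler_wpM2r => //; apply: ler_wpM2r.
apply: le_trans (degree_le i); rewrite [leRHS]big_mkcond/=; apply: ler_sum => j _.
have /andP[t0 t1] := tanh_slope_bounds (xi j - xi i).
case: ifPn => [_|/edge0->]; last by rewrite mul0r.
by rewrite -[leRHS]mulr1; apply: ler_wpM2l.
Qed.

Lemma hold_spread K s (r xi : 'I_N -> R) : 0 <= K -> 0 <= s <= h ->
  (forall i, `|hold_turn s r (phase_feedback xi) i
      - s * (lambda * phase_feedback xi i * mu)| <= K * radius_error r) ->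
  spread (fun i => xi i + hold_turn s r (phase_feedback xi) i)
    <= spread xi + 2 * (K * radius_error r).
Proof.
move=> K0 sh tK.
apply: (@spread_step _ _ _ _ (phase_weight s xi) (s * lambda * mu * c) _
  (fun i => hold_turn s r (phase_feedback xi) i
      - s * (lambda * phase_feedback xi i * mu))) => //.
- by rewrite mulr_ge0// radius_error_ge0.
- by move=> i; rewrite phase_weightE; ring.
- by move=> i j; apply: phase_weight_ge0; case/andP: sh.
- by move=> i; apply: le_trans (phase_weight_sum _ _ sh) _; exact: (ltW step_degree).
Qed.

(** The weighted sum of spread and radius error never increases, so both smallness conditions hold
    forever once they hold initially. The times [s] inside an interval are included to reach
    continuous time. *)
Lemma discrete_decay (T : rel 'I_N) root n : subrel T (edge A) -> (0 < n)%N ->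
  (forall v, reach T root n v) ->
  exists e1 D K sigma : R, [/\ 0 < e1, 1 <= D, 0 < K, 0 < sigma &
  forall r xi : nat -> 'I_N -> R,
    (forall k, r k.+1 = hold_rad h (r k) (phase_feedback (xi k))) ->
    (forall k i, xi k.+1 i = xi k i + hold_turn h (r k) (phase_feedback (xi k)) i) ->
    spread (xi 0%N) + D * radius_error (r 0%N) <= e1 ->
    forall k s, 0 <= s <= h ->
      spread (fun i => xi k i + hold_turn s (r k) (phase_feedback (xi k)) i)
        + radius_error (hold_rad s (r k) (phase_feedback (xi k)))
      <= K * (spread (xi 0%N) + D * radius_error (r 0%N))
           * expR (- sigma * (k%:R * h))].
Proof.
move=> TA n0 rn.
have [e0 [q [K1 [e00 /andP[q0 q1] K10 H]]]] := hold_bounds.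
have /andP[h0 _] := hh.
have hs : 0 <= h <= h by rewrite lexx (ltW h0).
pose kappa := h * lambda * mu ^+ 2.
have mu2 : 0 < mu ^+ 2 by rewrite exprn_even_gt0.
have kappa0 : 0 < kappa by rewrite mulr_gt0// mulr_gt0.
have [a a0 aP] := exists_pos_lower_bound (I := ('I_N * 'I_N)%type)
  (P := fun p => T p.1 p.2) (F := fun p => A p.2 p.1) (fun p Tp => TA _ _ Tp).
have tau0 := tanh_slope_min_gt0 R.
(* The smaller of the self-weight and the least weight of a tree edge when phase differences are at
   most 1. *)
pose beta := Num.min (1 - kappa * max_degree A) (kappa * (a * tanh_slope_min R)).
have beta0 : 0 < beta.
  by rewrite lt_min subr_gt0; apply/andP; split;
    [exact: step_degree|rewrite mulr_gt0// mulr_gt0].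
have betan0 : 0 < beta ^+ n by rewrite exprn_gt0.
have nR : 1 <= n%:R :> R by rewrite ler1n.
(* Over [n] steps the radius errors [E] add at most [2 n K1 E] to the spread. As
   [4 n K1 <= D (1 - q)], this is at most half of the gain [D (1 - q) E], which leaves the rate
   [(1 + q) / 2] for the radius part. *)
pose rho := Num.max (1 - beta ^+ n) ((1 + q) / 2).
pose D := 1 + 4 * n%:R * K1 / (1 - q).
have q1' : 0 < 1 - q by lra.
have nK : 0 < n%:R * K1 by rewrite mulr_gt0// (lt_le_trans ltr01).
have D1 : 1 <= D by rewrite /D lerDl divr_ge0 ?(ltW q1')// -mulrA mulr_ge0// ltW.
have Dq : 4 * n%:R * K1 <= D * (1 - q).
  have -> : D * (1 - q) = 1 - q + 4 * n%:R * K1 by rewrite /D; field; lra.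
  by lra.
have D0 : 0 < D by exact: lt_le_trans D1.
have rho01 : 0 < rho < 1.
  by rewrite lt_max gt_max; apply/andP; split; [apply/orP; right; lra|apply/andP; split; lra].
have [sigma sigma0 decay] := exp_decay n0 rho01 h0.
have /andP[rho0 rho1] := rho01.
(* The bound 1 keeps phase differences in the range of [tanh_slope_ge]; the factor [1 + 2 * K1]
   covers the growth of the spread inside an interval. *)
exists (Num.min e0 1), D, ((1 + 2 * K1) * rho^-1), sigma; split => //.
- by rewrite lt_min e00 ltr01.
- by rewrite mulr_gt0 ?invr_gt0//; lra.
move=> r xi rS xiS; rewrite le_min => /andP[S0e0 S01].
(* [D] is so large that the loss of radius error pays for its effect on the
   phases, both in one step and over [n] steps. *)
pose S k := spread (xi k) + D * radius_error (r k).
have fok k i : f_ok (phase_feedback (xi k) i) by exact: feedback_ok.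
have E0 k : 0 <= radius_error (r k) by exact: radius_error_ge0.
have DE0 k : radius_error (r k) <= D * radius_error (r k).
  by rewrite -[leLHS]mul1r ler_wpM2r.
have sp0 k : 0 <= spread (xi k) by exact: spread_ge0.
have S_ge0 k : 0 <= S k by have := DE0 k; have := E0 k; have := sp0 k; rewrite /S; lra.
have step k : S k <= e0 ->
    radius_error (r k.+1) <= q * radius_error (r k) /\ S k.+1 <= S k.
  move=> Sk; have Ek : radius_error (r k) <= e0.
    by have := DE0 k; have := sp0 k; move: Sk; rewrite /S; lra.
  have [Eq /(_ h hs)[_ _ tK]] := H (r k) _ Ek (fok k); rewrite -rS in Eq.
  split=> //; have := hold_spread (ltW K10) hs tK.
  rewrite (_ : (fun i => _) = xi k.+1); last by apply/funext => i; rewrite xiS.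
  move=> sp; rewrite /S.
  have : D * radius_error (r k.+1) <= D * (q * radius_error (r k)) by rewrite ler_pM2l.
  have : 4 * n%:R * K1 * radius_error (r k) <= D * (1 - q) * radius_error (r k).
    by rewrite ler_wpM2r.
  have : K1 * radius_error (r k) <= n%:R * (K1 * radius_error (r k)).
    by rewrite ler_peMl// mulr_ge0// ltW.
  have : 0 <= K1 * radius_error (r k) by rewrite mulr_ge0// ltW.
  lra.
have Sdec k : S k <= S 0%N.
  elim: k => // k IH; have [//|_ Sk] := step k; first exact: le_trans IH S0e0.
  exact: le_trans Sk IH.
have Se0 k : S k <= e0 by exact: le_trans (Sdec k) S0e0.
have Smono k : S k.+1 <= S k by have [] := step k (Se0 k).
have Eq k : radius_error (r k.+1) <= q * radius_error (r k) by have [] := step k (Se0 k).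
have Ele k : radius_error (r k) <= e0.
  by have := DE0 k; have := sp0 k; have := Se0 k; rewrite /S; lra.
have Edec m k : radius_error (r (m + k)%N) <= radius_error (r k).
  elim: m => // m IH; rewrite addSn; apply: le_trans (Eq _) _.
  by have := E0 (m + k)%N; nra.
have Sn k : S (n + k)%N <= rho * S k.
  have := @consensus _ _ T root beta (fun m => xi (m + k)%N)
    (fun m => phase_weight h (xi (m + k)%N)) (fun=> h * lambda * mu * c)
    (fun m => K1 * radius_error (r (m + k)%N))
    (fun m i => hold_turn h (r (m + k)%N) (phase_feedback (xi (m + k)%N)) i
       - h * (lambda * phase_feedback (xi (m + k)%N) i * mu)) (ltW beta0).
  move=> /(_ _ _ _ _ _ n rn).
  have Esum : \sum_(m < n) K1 * radius_error (r (m + k)%N) <= n%:R * (K1 * radius_error (r k)).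
    rewrite mulr_natl -[X in _ *+ X]card_ord -sumr_const; apply: ler_sum => m _.
    by rewrite ler_pM2l.
  have En : radius_error (r (n + k)%N) <= q * radius_error (r k).
    rewrite -(prednK n0) addSn; apply: le_trans (Eq _) _.
    by rewrite ler_pM2l.
  move=> cons; have {cons} : spread (xi (n + k)%N) <=
      (1 - beta ^+ n) * spread (xi k) + 2 * (n%:R * (K1 * radius_error (r k))).
    apply: le_trans (cons _ _ _ _ _) _.
    - by move=> m i; rewrite addSn xiS phase_weightE; ring.
    - by move=> m i j; apply: phase_weight_ge0; exact: ltW.
    - move=> m i; apply: le_trans (phase_weight_sum _ _ hs) _.
      have : beta <= 1 - kappa * max_degree A by rewrite ge_min lexx.
      rewrite -/kappa; lra.
    - move=> m u v Tuv; rewrite ge_min; apply/orP; right.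
      rewrite /phase_weight -/kappa ler_pM2l//.
      apply: ler_pM; rewrite ?(ltW a0) ?(ltW tau0)//; first exact: (aP (u, v)).
      apply: tanh_slope_ge; apply: le_trans (normr_le_spread _ _ _) _.
      apply: le_trans (le_trans (Sdec (m + k)%N) S01).
      by rewrite /S lerDl mulr_ge0// ltW.
    - move=> m i; have [_ /(_ h hs)[_ _]] := H _ _ (Ele (m + k)%N) (fok (m + k)%N).
      exact.
    - by rewrite lerD2l ler_pM2l.
  have : D * radius_error (r (n + k)%N) <= D * (q * radius_error (r k)) by rewrite ler_pM2l.
  have : 4 * n%:R * K1 * radius_error (r k) <= D * (1 - q) * radius_error (r k).
    by rewrite ler_wpM2r.
  have r1 : (1 - beta ^+ n) * spread (xi k) <= rho * spread (xi k).
    by apply: ler_wpM2r => //; rewrite le_max lexx.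
  have r2 : (1 + q) / 2 * (D * radius_error (r k)) <= rho * (D * radius_error (r k)).
    apply: ler_wpM2r; first by rewrite mulr_ge0// ltW.
    by rewrite le_max lexx orbT.
  rewrite /S mulrDr; lra.
move=> k s sh.
have [_ /(_ s sh)[_ Es tK]] := H _ _ (Ele k) (fok k).
have spk := hold_spread (ltW K10) sh tK.
apply: (@le_trans _ _ ((1 + 2 * K1) * S k)).
  have : K1 * radius_error (r k) <= K1 * (D * radius_error (r k)) by rewrite ler_pM2l.
  have : 0 <= K1 * spread (xi k) by rewrite mulr_ge0// ltW.
  have := DE0 k; rewrite /S; lra.
have Dk := decay S S_ge0 Smono Sn k.
rewrite -/(S 0%N) -[leRHS]mulrA -[leRHS]mulrA [_^-1 * _]mulrA ler_pM2l//; lra.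
Qed.

End Gains.

(** * Reachability from the root of a spanning tree *)

Section Reach.
Variables (N : nat) (T : rel 'I_N) (root : 'I_N).

Lemma reach_mono m n v : (m <= n)%N -> reach T root m v -> reach T root n v.
Proof.
move=> /subnKC <-; elim: (n - m)%N => [|k IH]; first by rewrite addn0.
by move=> /IH rv; rewrite addnS /= rv.
Qed.

Lemma reach_step n u v : reach T root n u -> T u v -> reach T root n.+1 v.
Proof. by move=> ru uv /=; apply/orP; right; apply/existsP; exists u; rewrite ru. Qed.

(** Connectedness is undirected, so a path from the root may use edges backwards. Going backwards is
    harmless: a reached node other than the root was reached through its only parent. *)
Lemma spanning_tree_reach : #|[pred u | T u root]| = 0%N ->
  (forall v, v != root -> #|[pred u | T u v]| = 1%N) ->
  (forall u v, connect [rel x y | T x y || T y x] u v) ->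
  exists2 n, (0 < n)%N & forall v, reach T root n v.
Proof.
move=> T0 T1 Tc.
have noparent u : ~~ T u root.
  by apply: contra_eqN T0 => uT; rewrite -lt0n; apply/card_gt0P; exists u.
have parent u v n : T u v -> reach T root n v -> reach T root n u.
  move=> uv; elim: n => [|n IH] /=; first by move=> /eqP vr;
    rewrite vr (negPf (noparent u)) in uv.
  move=> /orP[/IH->//|/existsP[w /andP[rw wv]]].
  have vr : v != root by apply: contraTneq uv => ->; exact: noparent.
  have /card_le1_eqP T1v := eq_leq (T1 _ vr).
  by rewrite (T1v w u)// rw.
have ex v : exists n, reach T root n v.
  have /connectP[p pp ->] := Tc root v.
  have r0 : exists n, reach T root n root by exists 0%N => /=.
  elim: p {1 3 5}root pp r0 => [|x p IH] y //= /andP[yx px] [n ry].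
  apply: IH => //; case/orP: yx => [yx|xy]; last by exists n; exact: parent ry.
  by exists n.+1; exact: reach_step yx.
have [g gP] := choice ex.
(* The successor makes the number of steps positive, as [exp_decay] divides by it. *)
exists (\max_v g v).+1 => // v; apply: (reach_mono _ (gP v)).
by apply: leqW; exact: leq_bigmax.
Qed.

End Reach.

(** * From edge errors modulo a full turn to real phases *)

Section PhaseLift.
Variables (R : realType) (N : nat) (T : rel 'I_N) (root : 'I_N).
Variables (zeta : 'I_N -> R) (e : R) (delta : 'I_N -> 'I_N -> R) (E : rel 'I_N).
Hypotheses (e_ge0 : 0 <= e) (TE : subrel T E)
  (delta_zeta : forall i j, E j i -> eqmod2pi (delta i j) (zeta j - zeta i))
  (delta_le : forall i j, E j i -> `|delta i j| <= e).

(** Summing errors down the tree gives representatives of size at most [n * e]. On every edge, in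
    the tree or not, [delta i j] and [xi j - xi i] are congruent and differ by at most
    [(2 * n + 1) * e < 2 * pi], hence agree. *)
Lemma phase_lift n : (forall v, reach T root n v) -> (2 * n%:R + 1) * e < 2 * pi ->
  exists xi : 'I_N -> R, spread xi <= 2 * n%:R * e /\
    forall i j, E j i -> delta i j = xi j - xi i.
Proof.
move=> rn small.
have lift m v : reach T root m v ->
    exists x, eqmod2pi x (zeta v - zeta root) /\ `|x| <= m%:R * e.
  elim: m v => [|m IH] v /=.
    move=> /eqP->; exists 0; rewrite subrr normr0 mul0r; split=> //.
    exact: eqmod2pi_refl.
  have [|_] := boolP [exists u, reach T root m u && T u v].
    move=> /existsP[u /andP[/IH[x [xz xe]] uv]] _.
    have Euv := TE uv; exists (x - delta v u); split.
      have := eqmod2piB xz (delta_zeta Euv).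
      by rewrite (_ : _ - _ - _ = zeta v - zeta root)//; ring.
    rewrite -natr1 mulrDl mul1r (le_trans (ler_normB _ _))// lerD//.
    exact: delta_le.
  rewrite orbF => /IH[x [xz xe]]; exists x; split => //.
  by rewrite (le_trans xe)// ler_wpM2r// ler_nat.
have [xi xiP] := choice (fun v => lift n v (rn v)).
have xiB i j : `|xi i - xi j| <= 2 * n%:R * e.
  rewrite (le_trans (ler_normB _ _))//.
  by have [_ +] := xiP i; have [_ +] := xiP j; lra.
exists xi; split.
  apply: spread_le => [|i j]; first by rewrite !mulr_ge0.
  exact: le_trans (ler_norm _) (xiB i j).
move=> i j Eji; apply: eqmod2pi_small.
  apply: eqmod2pi_trans (delta_zeta Eji) _; apply: eqmod2pi_sym.
  have := eqmod2piB (xiP j).1 (xiP i).1.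
  by rewrite (_ : _ - _ - (_ - _) = zeta j - zeta i)//; ring.
rewrite (le_lt_trans (ler_normB _ _))//.
by have := xiB j i; have := delta_le Eji; move: small; lra.
Qed.

End PhaseLift.

(** * Plane vectors, rotations and polar angles *)

Section Plane.
Variable R : realType.
Implicit Types (v w : 'cV[R]_2) (a : R).

Lemma sum_ord2 (F : 'I_2 -> R) : \sum_k F k = F 0 + F 1.
Proof.
by rewrite big_ord_recl big_ord1; congr (F _ + F _); apply/val_inj.
Qed.

Lemma enorm2 v : enorm v = Num.sqrt (v 0 0 ^+ 2 + v 1 0 ^+ 2).
Proof. by rewrite /enorm sum_ord2. Qed.

Lemma cV2_ext v w : v 0 0 = w 0 0 -> v 1 0 = w 1 0 -> v = w.
Proof.
move=> vw0 vw1; apply/matrixP => i j; rewrite ord1.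
have [->//|->//] : i = 0 \/ i = 1.
by case: i => [[|[|//]] ilt]; [left|right]; exact/val_inj.
Qed.

Lemma Phi_mul0 a v : (Phi a *m v) 0 0 = cos a * v 0 0 + sin a * v 1 0.
Proof. by rewrite mxE sum_ord2 !mxE. Qed.

Lemma Phi_mul1 a v : (Phi a *m v) 1 0 = - sin a * v 0 0 + cos a * v 1 0.
Proof. by rewrite mxE sum_ord2 !mxE. Qed.

Lemma enorm_Phi a v : enorm (Phi a *m v) = enorm v.
Proof.
rewrite !enorm2 Phi_mul0 Phi_mul1; congr Num.sqrt.
transitivity ((cos a ^+ 2 + sin a ^+ 2) * (v 0 0 ^+ 2 + v 1 0 ^+ 2)); first by ring.
by rewrite cos2Dsin2 mul1r.
Qed.

Lemma enorm_polar r a : 0 <= r -> enorm (r *: vec2 (cos a) (sin a)) = r.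
Proof.
move=> r0; rewrite enorm2 !mxE/= -[RHS]ger0_norm// -sqrtr_sqr.
by congr Num.sqrt; rewrite -[RHS]mulr1 -(cos2Dsin2 a); ring.
Qed.

Lemma enorm_eq0 v : enorm v = 0 -> v = 0.
Proof.
rewrite enorm2 => /eqP; rewrite sqrtr_eq0 => v0.
have : v 0 0 ^+ 2 + v 1 0 ^+ 2 = 0 by apply/le_anti; rewrite v0 addr_ge0 ?sqr_ge0.
move=> /eqP; rewrite paddr_eq0 ?sqr_ge0// !sqrf_eq0 => /andP[/eqP ? /eqP ?].
by apply: cV2_ext; rewrite mxE.
Qed.

Lemma polar_angleP v a : polar_angle v a <->
  [/\ 0 < enorm v, v 0 0 = enorm v * cos a & v 1 0 = enorm v * sin a].
Proof.
split=> [[v0 vE]|[v0 v1 v2]].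
  split; last 2 first.
  - by rewrite {1}vE !mxE.
  - by rewrite {1}vE !mxE.
  rewrite lt_def sqrtr_ge0 andbT; apply: contraNneq v0 => /enorm_eq0->; exact: eqxx.
split; first by apply: contraTneq v0 => ->; rewrite enorm2 !mxE expr0n/= addr0 sqrtr0 ltxx.
by apply: cV2_ext; rewrite !mxE.
Qed.

Lemma polar_angle_eqmod v a b : polar_angle v a -> polar_angle v b -> eqmod2pi a b.
Proof.
move=> /polar_angleP[v0 va1 va2] /polar_angleP[_ vb1 vb2].
have vn0 : enorm v != 0 by rewrite gt_eqF.
by apply: cos_sin_eqmod2pi; apply: (mulfI vn0);
  rewrite -?va1 -?va2.
Qed.

Lemma polar_angleW v a b : eqmod2pi a b -> polar_angle v a -> polar_angle v b.
Proof.
by move=> ab /polar_angleP[v0 va1 va2]; apply/polar_angleP;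
  rewrite -(eqmod2pi_cos ab) -(eqmod2pi_sin ab).
Qed.

Lemma is_derive_mxP (M : R -> 'cV[R]_2) (t : R) w : is_derive t 1 M w <->
  forall k, hasD (fun s => M s k 0) t (w k 0).
Proof.
split=> [Mw k|Mw].
  have dM := @ex_derive _ _ _ _ _ _ _ Mw.
  have := derive_mx dM; rewrite (@derive_val _ _ _ _ _ _ _ Mw) => ->.
  by rewrite mxE; apply: DeriveDef => //; exact: (derivable_mxP _ _ _).1 dM k 0.
have dM : derivable M t 1.
  by apply/derivable_mxP => i j; rewrite ord1; exact: (@ex_derive _ _ _ _ _ _ _ (Mw i)).
apply: DeriveDef => //; rewrite derive_mx//; apply/matrixP => i j.
by rewrite mxE ord1; exact: (@derive_val _ _ _ _ _ _ _ (Mw i)).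
Qed.

Lemma static_target (p0 v0 : R -> 'cV[R]_2) :
  (forall t : R, is_derive t 1 p0 (v0 t)) -> (forall t, v0 t = 0) ->
  forall t, p0 t = p0 0.
Proof.
move=> dp v00 t; apply/matrixP => i j; rewrite ord1.
apply: (@is_derive_0_is_cst _ (fun s => p0 s i 0)) => s.
by have /is_derive_mxP/(_ i) := dp s; rewrite v00 mxE.
Qed.

End Plane.

(** * Every trajectory follows the explicit hold formulas *)

Section ClosedLoop.
Variables (R : realType) (N : nat) (lambda gamma mu c h : R) (A : 'M[R]_N)
  (d : 'I_N -> 'I_N -> R) (rad : 'I_N -> R) (p0 v0 : R -> 'cV[R]_2).
Hypotheses (htarget : forall t : R, is_derive t 1 p0 (v0 t))
  (hstatic : forall t : R, v0 t = 0) (h_gt0 : 0 < h).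

Definition target_dist (q : config R N) i : R := enorm (target_local (p0 0) q i).

Lemma rangeE q i : target_dist q i = enorm (pos q i - p0 0).
Proof.
rewrite /target_dist /target_local enorm_Phi !enorm2 !mxE; congr Num.sqrt; ring.
Qed.

Lemma closed_loop_hold m k s :
  closed_loop lambda gamma mu c h A d rad p0 v0 m -> 0 <= s <= h ->
  let q := m (k%:R * h) in let f := angular_feedback mu c A d q in
  (forall i, target_dist (m (k%:R * h + s)) i =
     hold_rad lambda gamma rad s (target_dist q) f i) /\
  (forall i j, edge A j i -> sep (m (k%:R * h + s)) i j =
     sep q i j + hold_turn lambda gamma mu rad s (target_dist q) f j
               - hold_turn lambda gamma mu rad s (target_dist q) f i).
Proof.
move=> [_ wf cpos csep [u [du hu]]] /andP[s_ge0 s_le] q f.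
set s0 := k%:R * h in q f *.
have s0_ge0 : 0 <= s0 by rewrite mulr_ge0// ltW.
have p0E := static_target htarget hstatic.
pose x i t := pos (m t) i 0 0 - p0 0 0 0.
pose y i t := pos (m t) i 1 0 - p0 0 1 0.
have rhoE i t : target_dist (m t) i = Num.sqrt (x i t ^+ 2 + y i t ^+ 2).
  by rewrite rangeE enorm2 !mxE.
have sub : `[s0, s0 + h]%classic `<=` `[0, +oo[%classic.
  by move=> t /=; rewrite !in_itv/= andbT => /andP[+ _]; exact: le_trans.
have cx i (l : 'I_2) : {within `[s0, s0 + h], continuous (fun t => pos (m t) i l 0)}.
  move=> t; apply: (@continuous_comp _ _ _ _ (fun M : 'cV[R]_2 => M l 0)).
    exact: (continuous_subspaceW sub (cpos i)).
  exact: coord_continuous.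
have cst_within (z : R) : {within `[s0, s0 + h], continuous (fun=> z)}.
  by apply: continuous_subspaceT; exact: cst_continuous.
have polar i t : 0 <= t -> [/\ 0 < target_dist (m t) i,
    x i t = target_dist (m t) i * cos (bearing (m t) i) &
    y i t = target_dist (m t) i * sin (bearing (m t) i)].
  move=> t0; have [/(_ i)/polar_angleP + _] := wf t t0.
  by rewrite p0E -rangeE !mxE.
have t_ge0 t : s0 <= t -> 0 <= t by exact: le_trans.
pose w1 i := speed_rad lambda gamma rad i (target_dist q i) (f i).
pose w2 i := speed_tan lambda mu (target_dist q i) (f i).
have loc i t : s0 < t < s0 + h ->
    cos (bearing (m t) i) * u i t 0 0 + sin (bearing (m t) i) * u i t 1 0 = w1 i /\
    - sin (bearing (m t) i) * u i t 0 0 + cos (bearing (m t) i) * u i t 1 0 = w2 i.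
  move=> /andP[t1 t2]; have := hu i k t; rewrite -/s0 (ltW t1) t2 => /(_ isT).
  rewrite /controller hstatic mulmx0 addr0 p0E -/q => e.
  by rewrite -Phi_mul0 -Phi_mul1 e !mxE/=; split; rewrite /w1 /w2 /speed_rad /speed_tan.
have dx i t : s0 < t < s0 + h -> hasD (x i) t (u i t 0 0).
  move=> tI; have /is_derive_mxP/(_ 0) dpos := du i k t tI.
  exact: hasD_eq (hasDB dpos (hasD_cst _ t)) (subr0 _).
have dy i t : s0 < t < s0 + h -> hasD (y i) t (u i t 1 0).
  move=> tI; have /is_derive_mxP/(_ 1) dpos := du i k t tI.
  exact: hasD_eq (hasDB dpos (hasD_cst _ t)) (subr0 _).
have rho_gt0 i t : s0 <= t <= s0 + h -> 0 < Num.sqrt (x i t ^+ 2 + y i t ^+ 2).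
  by move=> /andP[t0 _]; rewrite -rhoE; have [] := polar i t (t_ge0 t t0).
have radial i t : s0 < t < s0 + h ->
    x i t * u i t 0 0 + y i t * u i t 1 0 = Num.sqrt (x i t ^+ 2 + y i t ^+ 2) * w1 i.
  move=> tI; rewrite -rhoE; have [<- _] := loc i t tI.
  have [_ -> ->] := polar i t (t_ge0 t (ltW (proj1 (andP tI)))); ring.
have transv i t : s0 < t < s0 + h ->
    x i t * u i t 1 0 - y i t * u i t 0 0 = Num.sqrt (x i t ^+ 2 + y i t ^+ 2) * w2 i.
  move=> tI; rewrite -rhoE; have [_ <-] := loc i t tI.
  have [_ -> ->] := polar i t (t_ge0 t (ltW (proj1 (andP tI)))); ring.
have cxi i : {within `[s0, s0 + h], continuous (x i)} by apply: withinB.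
have cyi i : {within `[s0, s0 + h], continuous (y i)} by apply: withinB.
have [x0 y0] : (forall i, x i s0 = Num.sqrt (x i s0 ^+ 2 + y i s0 ^+ 2) * cos (bearing q i)) /\
               (forall i, y i s0 = Num.sqrt (x i s0 ^+ 2 + y i s0 ^+ 2) * sin (bearing q i)).
  by split=> i; rewrite -rhoE; have [] := polar i s0 s0_ge0.
have hrad i t : s0 <= t <= s0 + h -> target_dist (m t) i = target_dist q i + (t - s0) * w1 i.
  move=> tI; rewrite /q !rhoE.
  exact: hold_radius (cxi i) (cyi i) (dx i) (dy i) (rho_gt0 i) (radial i) _ tI.
pose al i t := turn (target_dist q i) (w1 i) (w2 i) (t - s0).
have hpol i t : s0 <= t <= s0 + h ->
    x i t = target_dist (m t) i * cos (bearing q i + al i t) /\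
    y i t = target_dist (m t) i * sin (bearing q i + al i t).
  move=> tI; rewrite /al /q !rhoE.
  exact: hold_polar (ltW h_gt0) (cxi i) (cyi i) (dx i) (dy i) (rho_gt0 i)
    (radial i) (transv i) (x0 i) (y0 i) _ tI.
have sI : s0 <= s0 + s <= s0 + h by rewrite lerDl s_ge0 lerD2l.
(* Only a congruence is available: [bearing] may jump by full turns. *)
have bear i t : s0 <= t <= s0 + h -> eqmod2pi (bearing (m t) i) (bearing q i + al i t).
  move=> tI; have [xt yt] := hpol i t tI.
  have t0 : 0 <= t by apply: t_ge0; case/andP: tI.
  have [r0 xb yb] := polar i t t0.
  have rn0 : target_dist (m t) i != 0 by rewrite gt_eqF.
  by apply: cos_sin_eqmod2pi; apply: (mulfI rn0);
    rewrite -?xt -?yt.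
split=> [i|i j Eji].
  by rewrite hrad// /hold_rad addrAC subrr add0r.
have cal l : {within `[s0, s0 + h], continuous (al l)}.
  apply: (@hasD_within _ (fun t => w2 l / (target_dist q l + (t - s0) * w1 l) *
    (1 - 0))) => t tI.
  apply: (@hasD_comp _ (turn (target_dist q l) (w1 l) (w2 l))).
    apply: hasD_turn; rewrite -hrad//.
    by rewrite rhoE; exact: rho_gt0.
  by apply: hasDB; [exact: hasD_id|exact: hasD_cst].
(* The angular distance minus the net swept angle is continuous and stays in one class modulo
   [2 * pi], so it is constant; this turns congruences into equalities for [sep]. *)
pose g t := sep (m t) i j - (al j t - al i t).
have gE : g (s0 + s) = g s0.
  apply: (@eqmod2pi_continuous_cst _ g s0 (s0 + h) (bearing q j - bearing q i)) => //.
    apply: withinB; last exact: withinB.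
    exact: (continuous_subspaceW sub (csep i j Eji)).
  move=> t tI; have t0 : 0 <= t by apply: t_ge0; case/andP: tI.
  have [/(_ j) pj /(_ i j Eji) pij] := wf t t0.
  have e1 := polar_angle_eqmod pij pj.
  have e2 := eqmod2pi_trans e1 (bear j t tI).
  have e3 := eqmod2piB (eqmod2piB e2 (bear i t tI)) (eqmod2pi_refl (al j t - al i t)).
  rewrite (_ : g t = bearing (m t) i + sep (m t) i j - bearing (m t) i - (al j t - al i t)).
    rewrite (_ : bearing q j - bearing q i = bearing q j + al j t - (bearing q i + al i t)
       - (al j t - al i t)) //; ring.
  by rewrite /g; ring.
have al0 l : al l s0 = 0 by rewrite /al subrr turn0.
have als l : al l (s0 + s) = hold_turn lambda gamma mu rad s (target_dist q) f l.
  by rewrite /al addrAC subrr add0r.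
by move: gE; rewrite /g !al0 !als -/q; lra.
Qed.

End ClosedLoop.

(** * Sampling indices and gluing of continuous pieces *)

Section Sampling.
Variables (R : realType) (h : R).
Hypothesis h_gt0 : 0 < h.

Lemma sampling_index (t : R) : 0 <= t ->
  exists k : nat, k%:R * h <= t < k%:R * h + h.
Proof.
move=> t0; exists (Num.truncn (t / h)).
have /truncn_itv/andP[] : 0 <= t / h by rewrite divr_ge0// ltW.
by rewrite ler_pdivlMr// ltr_pdivrMr// -natr1 mulrDl mul1r => -> ->.
Qed.

Lemma truncn_sampling (k : nat) (t : R) : k%:R * h <= t < k%:R * h + h ->
  Num.truncn (t / h) = k.
Proof.
move=> /andP[k1 k2]; apply: truncn_def.
by rewrite ler_pdivlMr// k1 ltr_pdivrMr// -natr1 mulrDl mul1r.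
Qed.

(** Finitely many closed pieces glue by induction, and near a given time the half-line coincides
    with a finite union of them. *)
Lemma within_sampling (V : topologicalType) (f : R -> V) :
  (forall k : nat, {within `[k%:R * h, k%:R * h + h], continuous f}) ->
  {within `[0, +oo[, continuous f}.
Proof.
move=> cf.
have cn n : {within `[0, n%:R * h], continuous f}.
  elim: n => [|n IH].
    apply: continuous_subspaceW (cf 0%N) => t /=.
    by rewrite !in_itv/= mul0r add0r => /andP[-> /le_trans->]//; exact: ltW.
  have cU := withinU_continuous (@interval_closed _ (BLeft 0) (BRight (n%:R * h)) isT isT)
    (@interval_closed _ (BLeft (n%:R * h)) (BRight (n%:R * h + h)) isT isT) IH (cf n).
  apply: continuous_subspaceW cU => t /=; rewrite !in_itv/= => /andP[t0 tn].
  have [tnh|tnh] := leP t (n%:R * h); [left|right]; first by rewrite t0.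
  by rewrite ltW//= (le_trans tn)// -natr1 mulrDl mul1r.
apply/subspace_continuousP => t /= t0.
have {}t0 : 0 <= t by move: t0; rewrite in_itv/= andbT.
have [k /andP[_ tk]] := sampling_index t0.
have {}tk : t < k.+1%:R * h by rewrite -natr1 mulrDl mul1r.
have /subspace_continuousP/(_ t) := cn k.+1.
rewrite /= in_itv/= t0 (ltW tk) => /(_ isT) ct B /ct nB.
have {}nB : \forall s \near t, `[0, k.+1%:R * h]%classic s -> B (f s) := nB.
suff : \forall s \near t, `[0, +oo[%classic s -> B (f s) by [].
apply: filterS2 nB (lt_nbhsl tk) => s /= sB stk.
by rewrite in_itv/= andbT => s0; apply: sB; rewrite in_itv/= s0 ltW.
Qed.

End Sampling.

(** * Construction of a global trajectory *)

Section Existence.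
Variables (R : realType) (N : nat) (lambda gamma mu c h : R) (A : 'M[R]_N)
  (d : 'I_N -> 'I_N -> R) (rad : 'I_N -> R) (p0 v0 : R -> 'cV[R]_2).
Hypotheses (htarget : forall t : R, is_derive t 1 p0 (v0 t))
  (hstatic : forall t : R, v0 t = 0) (h_gt0 : 0 < h).
Local Notation radius_after := (hold_rad lambda gamma rad).
Local Notation angle_after := (hold_turn lambda gamma mu rad).
Local Notation fb := (feedback mu c A).
Local Notation dist0 := (target_dist p0).

(** The set [good] is an invariant region of radii in which no agent hits the target, so the
    discrete map can be iterated forever and interpolated by the hold formulas. *)
Lemma closed_loop_exists (good : ('I_N -> R) -> Prop) (q : config R N) :
  (forall r delta, good r -> good (radius_after h r (fb delta)) /\
     forall s i, 0 <= s <= h -> 0 < radius_after s r (fb delta) i) ->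
  initial_config A (p0 0) q -> good (dist0 q) ->
  exists m, closed_loop lambda gamma mu c h A d rad p0 v0 m /\ m 0 = q.
Proof.
move=> goodP iq gq; have [[wf1 wf2] sep_q] := iq.
have p0E := static_target htarget hstatic.
have hh : 0 <= h <= h by rewrite lexx (ltW h_gt0).
(* [psi] holds the angles swept since time 0; unlike polar angles they are free of any choice modulo
   [2 * pi]. *)
pose delta (psi : 'I_N -> R) i j := sep q i j + psi j - psi i - d i j.
pose step (st : ('I_N -> R) * ('I_N -> R)) :=
  (radius_after h st.1 (fb (delta st.2)),
   fun i => st.2 i + angle_after h st.1 (fb (delta st.2)) i).
pose st k := iter k step (dist0 q, fun=> 0).
have goodst k : good (st k).1.
  by elim: k => [|k IH] //=; exact: (goodP _ _ IH).1.
pose F k := fb (delta (st k).2).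
pose lr k i t := radius_after (t - k%:R * h) (st k).1 (F k) i.
pose lp k i t := (st k).2 i + angle_after (t - k%:R * h) (st k).1 (F k) i.
pose idx t := Num.truncn (t / h).
pose rr i t := lr (idx t) i t.
pose ps i t := lp (idx t) i t.
have hold_rad0 r f i : radius_after 0 r f i = r i by rewrite /hold_rad mul0r addr0.
have hold_turn0 r f i : angle_after 0 r f i = 0 by rewrite /hold_turn turn0.
(* At the right endpoint the index already is [k.+1], but both formulas agree there; continuity on
   closed pieces rests on this. *)
have loc k i t : k%:R * h <= t <= k%:R * h + h -> rr i t = lr k i t /\ ps i t = lp k i t.
  move=> /andP[t1]; rewrite le_eqVlt => /orP[/eqP->|t2]; last first.
    by rewrite /rr /ps /idx (@truncn_sampling _ _ h_gt0 k)// t1.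
  have -> : k%:R * h + h = k.+1%:R * h by rewrite -natr1 mulrDl mul1r.
  rewrite /rr /ps /idx (@truncn_sampling _ _ h_gt0 k.+1) ?lexx ?ltrDl//.
  rewrite /lr /lp subrr hold_rad0 hold_turn0 addr0 /=.
  by rewrite -natr1 mulrDl mul1r addrAC subrr add0r.
have lr_gt0 k i t : k%:R * h <= t <= k%:R * h + h -> 0 < lr k i t.
  move=> tI; apply: (goodP _ _ (goodst k)).2.
  by rewrite subr_ge0 lerBlDl.
pose m t := Config (fun i => p0 0 + rr i t *:
     vec2 (cos (bearing q i + ps i t)) (sin (bearing q i + ps i t)))
  (fun i => bearing q i + ps i t) (fun i j => sep q i j + ps j t - ps i t).
have kI k t : k%:R * h <= t < k%:R * h + h -> k%:R * h <= t <= k%:R * h + h.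
  by move=> /andP[-> /ltW->].
have rr_gt0 i t : 0 <= t -> 0 < rr i t.
  by move=> /(sampling_index h_gt0)[k /kI tk]; have [-> _] := loc k i t tk; exact: lr_gt0.
have h0I : 0%:R * h <= 0 <= 0%:R * h + h by rewrite mul0r add0r lexx (ltW h_gt0).
have [rr0 ps0] : (forall i, rr i 0 = dist0 q i) /\ (forall i, ps i 0 = 0).
  split=> i; have [e1 e2] := loc 0%N i 0 h0I; rewrite ?e1 ?e2 /lr /lp mul0r subrr.
    by rewrite hold_rad0.
  by rewrite hold_turn0 addr0.
have m0 : m 0 = q.
  have posE : (fun i => p0 0 + rr i 0 *: vec2 (cos (bearing q i + ps i 0))
      (sin (bearing q i + ps i 0))) = pos q.
    apply/funext => i; rewrite rr0 ps0 addr0 rangeE.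
    by have [_ <-] := wf1 i; rewrite addrC subrK.
  have bE : (fun i => bearing q i + ps i 0) = bearing q.
    by apply/funext => i; rewrite ps0 addr0.
  have sE : (fun i j => sep q i j + ps j 0 - ps i 0) = sep q.
    by apply/funext => i; apply/funext => j; rewrite !ps0 addr0 subr0.
  by rewrite /m posE bE sE; case: (q).
have pol i t : 0 <= t -> polar_angle (pos (m t) i - p0 0) (bearing q i + ps i t).
  move=> t0; have r0 := rr_gt0 i t t0.
  rewrite /= addrAC subrr add0r; apply/polar_angleP.
  by rewrite enorm_polar ?(ltW r0)// !mxE.
have wfm t : 0 <= t -> wf_config A (p0 t) (m t).
  move=> t0; rewrite p0E; split => [i|i j Eji]; first exact: pol.
  apply: polar_angleW (pol j t t0).
  have := eqmod2piD (polar_angle_eqmod (wf1 j) (wf2 i j Eji)) (eqmod2pi_refl (ps j t)).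
  rewrite (_ : bearing (m t) i + _ = bearing q i + sep q i j + ps j t)//.
  by rewrite /=; ring.
have dlr k i t : hasD (lr k i) t (speed_rad lambda gamma rad i ((st k).1 i) (F k i)).
  exact: hasD_affine.
have dlp k i t : k%:R * h <= t <= k%:R * h + h ->
    hasD (lp k i) t (speed_tan lambda mu ((st k).1 i) (F k i) / lr k i t).
  move=> tI; have lr0 := lr_gt0 k i t tI.
  apply: hasD_eq.
    apply: hasDD; first exact: hasD_cst.
    apply: (@hasD_comp _ (turn ((st k).1 i) (speed_rad lambda gamma rad i ((st k).1 i) (F k i))
      (speed_tan lambda mu ((st k).1 i) (F k i)))).
      exact: hasD_turn.
    by apply: hasDB; [exact: hasD_id|exact: hasD_cst].
  by rewrite subr0 mulr1 add0r.
have cps i : {within `[0, +oo[, continuous (ps i)}.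
  apply: (within_sampling h_gt0) => k.
  apply: (@subspace_eq_continuous _ _ _ (lp k i)); last exact: hasD_within (dlp k i).
  by move=> t; rewrite inE/= in_itv/= => /(loc k i)[_ /esym].
have crr i : {within `[0, +oo[, continuous (rr i)}.
  apply: (within_sampling h_gt0) => k.
  apply: (@subspace_eq_continuous _ _ _ (lr k i)).
    by move=> t; rewrite inE/= in_itv/= => /(loc k i)[/esym].
  by apply: (@hasD_within _ (fun=> speed_rad lambda gamma rad i ((st k).1 i) (F k i))) => t _.
exists m; split => //; split => //.
- by rewrite m0.
- move=> i.
  pose X t := rr i t * cos (bearing q i + ps i t).
  pose Y t := rr i t * sin (bearing q i + ps i t).
  have cb : {within `[0, +oo[, continuous (fun t => bearing q i + ps i t)}.
    by apply: withinD => //; apply: continuous_subspaceT; exact: cst_continuous.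
  have cX : {within `[0, +oo[, continuous X}.
    by apply: withinM => //; apply: within_comp => //; exact: continuous_cos.
  have cY : {within `[0, +oo[, continuous Y}.
    by apply: withinM => //; apply: within_comp => //; exact: continuous_sin.
  have posE : (fun t => pos (m t) i) =
      (fun t => p0 0 + (X t *: vec2 1 0 + Y t *: vec2 0 1)).
    apply/funext => t /=; congr (_ + _); apply: cV2_ext; rewrite !mxE/= /X /Y; ring.
  have cZ (Z : R -> R) (v : 'cV[R]_2) : {within `[0, +oo[, continuous Z} ->
      {within `[0, +oo[, continuous (fun t => Z t *: v)}.
    by move=> cZ t; apply: (continuousZ (cZ t)); exact: cst_continuous.
  have c0 : {within `[0, +oo[, continuous (fun _ : R => p0 0)}.
    by apply: continuous_subspaceT; exact: cst_continuous.
  rewrite posE => t.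
  exact: continuousD (c0 t) (continuousD (cZ _ _ cX t) (cZ _ _ cY t)).
- move=> i j _; apply: withinB => //; apply: withinD => //.
  by apply: continuous_subspaceT; exact: cst_continuous.
(* The input in the global frame is the controller turned back by the inverse rotation, which is the
   transpose. *)
pose u i t : 'cV[R]_2 := (Phi (bearing (m t) i))^T *m
  controller lambda gamma mu c A d rad (p0 ((idx t)%:R * h)) (v0 ((idx t)%:R * h))
    (m ((idx t)%:R * h)) i.
have ctrl i k : controller lambda gamma mu c A d rad (p0 (k%:R * h)) (v0 (k%:R * h))
    (m (k%:R * h)) i = vec2 (speed_rad lambda gamma rad i ((st k).1 i) (F k i))
                            (speed_tan lambda mu ((st k).1 i) (F k i)).
  have kk : k%:R * h <= k%:R * h <= k%:R * h + h by rewrite lexx lerDl (ltW h_gt0).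
  have kh0 : 0 <= k%:R * h by rewrite mulr_ge0// ltW.
  have rk l : rr l (k%:R * h) = (st k).1 l.
    by have [-> _] := loc k l _ kk; rewrite /lr subrr hold_rad0.
  have pk l : ps l (k%:R * h) = (st k).2 l.
    by have [_ ->] := loc k l _ kk; rewrite /lp subrr hold_turn0 addr0.
  have tk : enorm (target_local (p0 0) (m (k%:R * h)) i) = (st k).1 i.
    rewrite -/(dist0 _ i) rangeE /= addrAC subrr add0r enorm_polar ?rk//.
    by rewrite -rk ltW// rr_gt0.
  have fk : angular_feedback mu c A d (m (k%:R * h)) i = F k i.
    rewrite /angular_feedback /F /feedback; congr (_ + _ * _).
    by apply: eq_bigr => j _; rewrite /= !pk.
  rewrite /controller hstatic mulmx0 addr0 p0E tk fk.
  by apply: cV2_ext; rewrite !mxE/= /speed_rad /speed_tan.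
exists u; split => [i k t tI|i k t tI]; last first.
  rewrite /u mulmxA (_ : Phi _ *m _ = 1%:M); last first.
    apply/matrixP => a b; rewrite mxE sum_ord2 !mxE.
    have cs2 := cos2Dsin2 (bearing (m t) i).
    by case: a => [[|[|//]] ?]; case: b => [[|[|//]] ?]; rewrite /= -?cs2; ring.
  by rewrite mul1mx /idx (truncn_sampling h_gt0 tI).
have tI' : k%:R * h <= t <= k%:R * h + h by case/andP: tI => /ltW-> /ltW->.
have idxt : idx t = k.
  by apply: truncn_sampling => //; case/andP: tI => /ltW-> ->.
have lr0 := lr_gt0 k i t tI'.
pose M s := p0 0 + lr k i s *: vec2 (cos (bearing q i + lp k i s)) (sin (bearing
  q i + lp k i s)).
apply: (@near_eq_is_derive _ _ _ M).
  have : t \in `]k%:R * h, k%:R * h + h[ by rewrite in_itv.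
  move=> /near_in_itvoo; apply: filterS => s; rewrite in_itv/= => /andP[s1 s2].
  by have [e1 e2] := loc k i s ltac:(by rewrite !ltW); rewrite /M /= e1 e2.
have dphi : hasD (fun s => bearing q i + lp k i s) t
    (0 + speed_tan lambda mu ((st k).1 i) (F k i) / lr k i t).
  by apply: hasDD; [exact: hasD_cst|exact: dlp].
have uE : u i t = \col_(l < 2) if l == 0
  then cos (bearing q i + lp k i t) * speed_rad lambda gamma rad i ((st k).1 i) (F k i)
     - sin (bearing q i + lp k i t) * speed_tan lambda mu ((st k).1 i) (F k i)
  else sin (bearing q i + lp k i t) * speed_rad lambda gamma rad i ((st k).1 i) (F k i)
     + cos (bearing q i + lp k i t) * speed_tan lambda mu ((st k).1 i) (F k i).
  rewrite /u idxt ctrl; have [_ bE] := loc k i t tI'.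
  by apply: cV2_ext; rewrite mxE sum_ord2 !mxE/= bE; ring.
apply/is_derive_mxP => l; rewrite uE mxE.
have [->|l0] := eqVneq l 0.
  rewrite (_ : (fun s => M s 0 0) = fun s => p0 0 0 0 + lr k i s * cos (bearing
    q i + lp k i s)); last first.
    by apply/funext => s; rewrite !mxE.
  apply: (hasD_eq (hasDD (hasD_cst _ t) (hasDM (dlr k i t) (hasD_cos dphi)))).
  by field; rewrite gt_eqF.
have -> : l = 1 by case: l l0 => [[|[|//]] ?] // _; exact/val_inj.
rewrite (_ : (fun s => M s 1 0) = fun s => p0 0 1 0 + lr k i s * sin (bearing q
  i + lp k i s)); last first.
  by apply/funext => s; rewrite !mxE.
apply: (hasD_eq (hasDD (hasD_cst _ t) (hasDM (dlr k i t) (hasD_sin dphi)))).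
by field; rewrite gt_eqF.
Qed.

End Existence.

(** * The formation error against radius errors and spread *)

Section FormationError.
Variables (R : realType) (N : nat) (A : 'M[R]_N) (d : 'I_N -> 'I_N -> R)
  (rad : 'I_N -> R) (p0 : R -> 'cV[R]_2).
Implicit Types q : config R N.

Lemma formation_errorE q : formation_error A d rad (p0 0) q =
  radius_error rad (target_dist p0 q) +
  \sum_i \sum_(j | edge A j i) `|sep q i j - d i j|.
Proof. by []. Qed.

Lemma sep_error_ge0 q : 0 <= \sum_i \sum_(j | edge A j i) `|sep q i j - d i j|.
Proof. by apply: sumr_ge0 => i _; apply: sumr_ge0. Qed.

Lemma radius_error_le q : radius_error rad (target_dist p0 q) <= formation_error
  A d rad (p0 0) q.
Proof. by rewrite formation_errorE lerDl sep_error_ge0. Qed.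

Lemma formation_error_ge0 q : 0 <= formation_error A d rad (p0 0) q.
Proof. exact: le_trans (radius_error_ge0 _ _) (radius_error_le q). Qed.

Lemma sep_error_le q i j : edge A j i ->
  `|sep q i j - d i j| <= formation_error A d rad (p0 0) q.
Proof.
move=> Eji; apply: (@le_trans _ _ (\sum_i \sum_(j | edge A j i) `|sep q i j - d i j|)).
  rewrite (bigD1 i)//= (bigD1 j)//= -addrA lerDl addr_ge0//; apply: sumr_ge0 => // k _.
  exact: sumr_ge0.
by rewrite formation_errorE lerDr radius_error_ge0.
Qed.

Lemma desired_formationP q : desired_formation A d rad (p0 0) q <->
  formation_error A d rad (p0 0) q <= 0.
Proof.
split=> [[r0 s0]|e0].
  rewrite /formation_error big1 ?add0r => [|i _]; last by rewrite r0 subrr normr0.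
  by rewrite big1// => i _; rewrite big1// => j Eji; rewrite s0// subrr normr0.
split=> [i|i j Eji]; apply/eqP; rewrite -subr_eq0 -normr_le0; apply: le_trans e0.
  by apply: le_trans (radius_error_ge _ _ _) (radius_error_le q).
exact: sep_error_le.
Qed.

Lemma sep_error_spread q (x : 'I_N -> R) :
  (forall i j, edge A j i -> sep q i j - d i j = x j - x i) ->
  \sum_i \sum_(j | edge A j i) `|sep q i j - d i j| <= N%:R * N%:R * spread x.
Proof.
move=> qx; apply: (@le_trans _ _ (\sum_(i < N) \sum_(j < N) spread x)).
  apply: ler_sum => i _; rewrite [leRHS](bigID (fun j => edge A j i))/=.
  apply: ler_wpDr; first by apply: sumr_ge0 => j _; exact: spread_ge0.
  by apply: ler_sum => j Eji; rewrite qx// normr_le_spread.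
by rewrite !sumr_const !card_ord -mulrA !mulr_natl.
Qed.

Lemma admissible_eqmod2pi (dd : 'I_N -> R) i j :
  (forall i j, edge A j i -> d i j =
     if 0 <= dd j - dd i then dd j - dd i else dd j - dd i + 2 * pi) ->
  edge A j i -> eqmod2pi (d i j) (dd j - dd i).
Proof.
move=> dE Eji; rewrite dE//; case: ifP => _; [exact: eqmod2pi_refl|exact: eqmod2piD2pi].
Qed.

End FormationError.

(** * Exponential stability and invariance of the formation *)

Section Stability.
Variables (R : realType) (N : nat) (lambda gamma mu c h : R)
  (A : 'M[R]_N) (d : 'I_N -> 'I_N -> R) (rad : 'I_N -> R)
  (p0 v0 : R -> 'cV[R]_2).
Hypotheses (hN : (2 <= N)%N) (hlambda : 0 < lambda) (hgamma : 0 < gamma)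
    (hmu : mu != 0) (hA : forall i j, 0 <= A i j)
    (htree : has_directed_spanning_tree (edge A))
    (hadm : admissible A d rad)
    (htarget : forall t : R, is_derive t 1 p0 (v0 t))
    (hstatic : forall t : R, v0 t = 0)
    (hc : `|mu| * max_degree A < c)
    (hh : 0 < h < h_max lambda gamma mu c A rad).

Lemma stability : formation_locally_exp_stable lambda gamma mu c h A d rad p0 v0.
Proof.
have [rad_gt0 _ [dd [_ ddE]]] := hadm.
have dmod i j := @admissible_eqmod2pi _ _ _ _ dd i j ddE.
have [T [root [TA T0 T1 Tc]]] := htree.
have [n n0 rn] := spanning_tree_reach T0 T1 Tc.
have [e1 [D [K [sigma [e10 D1 K0 sigma0 decay]]]]] :=
  discrete_decay hN hlambda hgamma hmu hA rad_gt0 hc hh TA n0 rn.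
have [e0 [q [K1 [e00 /andP[q0 q1] _ bounds]]]] :=
  hold_bounds hN hlambda hgamma hmu hA rad_gt0 hc hh.
have /andP[h_gt0 _] := hh.
have p0E := static_target htarget hstatic.
have nR : 0 <= n%:R :> R by [].
(* The phase lift bounds the initial spread by [2 * n] times the formation error, and the weighted
   radius error is at most [D] times it. *)
pose L := 2 * n%:R + D.
have L0 : 0 < L by rewrite /L; lra.
(* The three thresholds serve [discrete_decay], [phase_lift] (where [1 < 2 * pi]) and existence. In
   the gain, [N * N] bounds the number of edges and [expR (sigma * h)] covers the time since the
   last sample. *)
exists (Num.min (Num.min (e1 / L) (1 / (2 * n%:R + 1))) e0),
  ((1 + N%:R * N%:R) * K * L * expR (sigma * h)), sigma.
have NN : 0 <= N%:R * N%:R :> R by rewrite mulr_ge0.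
split => //.
- by rewrite !lt_min e00 !divr_gt0//; lra.
- by rewrite !mulr_gt0 ?expR_gt0//; lra.
- move=> qc iq; rewrite lt_min => /andP[_ qe].
  apply: (@closed_loop_exists _ _ _ _ _ _ _ _ _ _ _ _ htarget hstatic h_gt0
    (fun r => radius_error rad r <= e0)) => // [r delta re|].
    have fok i := feedback_ok mu c hA delta i.
    have [b1 b2] := bounds r _ re fok; split.
      by apply: le_trans b1 _; have := radius_error_ge0 rad r; nra.
    by move=> s i /b2[].
  exact: le_trans (radius_error_le _ _ _ _ _) (ltW qe).
move=> m mcl; set err := formation_error A d rad (p0 0) (m 0).
rewrite !lt_min ltr_pdivlMr// ltr_pdivlMr; last by lra.
move=> /andP[/andP[err1 err2] _] t t0.
have err0 : 0 <= err by exact: formation_error_ge0.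
have [[[wf1 wf2] _] _ _ _ _] := mcl.
have [xi0 [xi0_le xi0E]] : exists xi : 'I_N -> R, spread xi <= 2 * n%:R * err /\
    forall i j, edge A j i -> sep (m 0) i j - d i j = xi j - xi i.
  apply: (@phase_lift _ _ T root (fun i => bearing (m 0) i - dd i)) => //.
  - move=> i j Eji.
    have e2 := eqmod2piB (eqmod2piB (polar_angle_eqmod (wf2 i j Eji) (wf1 j))
      (eqmod2pi_refl (bearing (m 0) i))) (dmod i j Eji).
    have E1 : bearing (m 0) i + sep (m 0) i j - bearing (m 0) i - d i j =
      sep (m 0) i j - d i j by ring.
    have E2 : bearing (m 0) j - bearing (m 0) i - (dd j - dd i) =
      bearing (m 0) j - dd j - (bearing (m 0) i - dd i) by ring.
    by rewrite E1 E2 in e2.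
  - by move=> i j; exact: sep_error_le.
  - by have := @pi_ge2 R; move: err2; rewrite mulrC; lra.
pose r k := target_dist p0 (m (k%:R * h)).
(* Phases are lifted only at time 0 and then propagated; [inv] shows that they keep representing the
   separations. *)
pose xi := fix xi k : 'I_N -> R := if k is l.+1 then
  fun i => xi l i + hold_turn lambda gamma mu rad h (r l) (phase_feedback mu c A (xi l)) i
  else xi0.
have fbE k : (forall i j, edge A j i -> sep (m (k%:R * h)) i j - d i j = xi k j - xi k i) ->
    angular_feedback mu c A d (m (k%:R * h)) = phase_feedback mu c A (xi k).
  move=> inv; apply/funext => i; rewrite /angular_feedback /phase_feedback /feedback.
  by congr (_ + _ * _); apply: eq_bigr => j Eji; rewrite inv.
have hI : 0 <= h <= h by rewrite lexx (ltW h_gt0).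
have kS k : k%:R * h + h = k.+1%:R * h by rewrite -natr1 mulrDl mul1r.
have inv k : forall i j, edge A j i ->
    sep (m (k%:R * h)) i j - d i j = xi k j - xi k i.
  elim: k => [|k IH] i j Eji; first by rewrite mul0r; exact: xi0E.
  have [_ /(_ i j Eji)] := closed_loop_hold htarget hstatic h_gt0 k mcl hI.
  by rewrite kS fbE// => ->; have := IH i j Eji; rewrite -/(r k) /=; lra.
have rS k : r k.+1 = hold_rad lambda gamma rad h (r k) (phase_feedback mu c A (xi k)).
  apply/funext => i; have [/(_ i) + _] := closed_loop_hold htarget hstatic h_gt0 k mcl hI.
  by rewrite kS (fbE k (inv k)).
have S0_le : spread (xi 0%N) + D * radius_error rad (r 0%N) <= L * err.
  have : radius_error rad (r 0%N) <= err.
    by rewrite /r mul0r; exact: radius_error_le.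
  by move=> re; have : D * radius_error rad (r 0%N) <= D * err;
    [rewrite ler_wpM2l//; lra|rewrite /L /=; lra].
have S0e1 : spread (xi 0%N) + D * radius_error rad (r 0%N) <= e1.
  by rewrite (le_trans S0_le)// mulrC ltW.
have [k /andP[k1 k2]] := sampling_index h_gt0 t0.
pose s := t - k%:R * h.
have sI : 0 <= s <= h by rewrite /s; apply/andP; split; lra.
have tE : t = k%:R * h + s by rewrite /s; ring.
have dec := decay r xi rS (fun _ _ => erefl) S0e1 k s sI.
rewrite p0E formation_errorE tE.
have [rs ss] := closed_loop_hold htarget hstatic h_gt0 k mcl sI.
rewrite (fbE k (inv k)) in rs ss.
have -> : target_dist p0 (m (k%:R * h + s)) =
    hold_rad lambda gamma rad s (r k) (phase_feedback mu c A (xi k)).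
  by apply/funext => i; rewrite rs.
have sepE := @sep_error_spread _ _ A d (m (k%:R * h + s)) (fun i => xi k i +
  hold_turn lambda gamma mu rad s (r k) (phase_feedback mu c A (xi k)) i).
have {}sepE := sepE (fun i j Eji => ltac:(rewrite ss//; have := inv k i j Eji;
  rewrite -/(r k); lra)).
set sp := spread _ in dec sepE; set re := radius_error _ (hold_rad _ _ _ s _ _) in dec *.
have sp0 : 0 <= sp by exact: spread_ge0.
have re0 : 0 <= re by exact: radius_error_ge0.
apply: (@le_trans _ _ ((1 + N%:R * N%:R) * (sp + re))); first by nra.
rewrite -tE -!mulrA ler_pM2l; last by lra.
apply: (le_trans dec).
rewrite -mulrA ler_pM2l//.
apply: (@le_trans _ _ (L * err * expR (- sigma * (k%:R * h)))).
  by apply: ler_wpM2r => //; exact: expR_ge0.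
rewrite -mulrA ler_pM2l// [leRHS]mulrCA ler_wpM2l// -expRD ler_expR.
have : 0 <= sigma * (k%:R * h + h - t) by rewrite mulr_ge0 ?(ltW sigma0)//; lra.
lra.
Qed.

Lemma equilibrium : formation_equilibrium lambda gamma mu c h A d rad p0 v0.
Proof.
have [rad_gt0 dI [dd [_ ddE]]] := hadm.
have p0E := static_target htarget hstatic.
split.
  exists (Config (fun i => p0 0 + rad i *: vec2 (cos (dd i)) (sin (dd i))) dd d).
  have pol i : polar_angle (p0 0 + rad i *: vec2 (cos (dd i)) (sin (dd i)) - p0 0) (dd i).
    rewrite addrAC subrr add0r; apply/polar_angleP.
    by rewrite enorm_polar ?ltW// !mxE.
  split; last first.
    split=> // i; rewrite -/(target_dist p0 _ i) rangeE /= addrAC subrr add0r.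
    by rewrite enorm_polar// ltW.
  split=> //; split=> //= i j Eji; apply: polar_angleW (pol j); apply: eqmod2pi_sym.
  have := eqmod2piD (eqmod2pi_refl (dd i)) (admissible_eqmod2pi ddE Eji).
  by rewrite (_ : dd i + (dd j - dd i) = dd j)//; ring.
(* Invariance is the exponential estimate with zero initial error. *)
move=> m mcl /desired_formationP e0 t t0.
have [delta [K [sigma [delta0 _ _ _ /(_ m mcl)]]]] := stability.
move=> /(_ (le_lt_trans e0 delta0) t t0); rewrite p0E => et.
apply/desired_formationP; apply: (le_trans et).
have := formation_error_ge0 A d rad p0 (m 0) => e0'.
have -> : formation_error A d rad (p0 0) (m 0) = 0 by apply/le_anti; rewrite e0 e0'.
by rewrite mulr0 mul0r.
Qed.

End Stability.

Theorem theorem2 (R : realType) (N : nat) (lambda gamma mu c h : R)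
    (A : 'M[R]_N) (d : 'I_N -> 'I_N -> R) (rad : 'I_N -> R)
    (p0 v0 : R -> 'cV[R]_2)
    (hN : (2 <= N)%N) (hlambda : 0 < lambda) (hgamma : 0 < gamma)
    (hmu : mu != 0) (hA : forall i j, 0 <= A i j)
    (htree : has_directed_spanning_tree (edge A))
    (hadm : admissible A d rad)
    (htarget : forall t : R, is_derive t 1 p0 (v0 t))
    (hstatic : forall t : R, v0 t = 0)
    (hc : `|mu| * max_degree A < c)
    (hh : 0 < h < h_max lambda gamma mu c A rad) :
  formation_equilibrium lambda gamma mu c h A d rad p0 v0 /\
  formation_locally_exp_stable lambda gamma mu c h A d rad p0 v0.
Proof.
split; first exact: equilibrium.
exact: stability.
Qed.
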